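(* Let $\Phi:[0,\infty)\to[0,\infty)$ be convex and non-decreasing and let $(\mu_n)$ be a sequence of reals. In the setting described in the context, suppose there exists $\epsilon_o>0$ such that the random transformation $\mathcal R$ satisfies assumption (A1). Let $\alpha:=\frac13P(Z_1=\mathbf A,Z_3=\mathbf B)$ and $b(q):=\sqrt{2\pi q(1-q)}\exp\big[\frac{1}{2q(1-q)}\big]$. Then for every constant $c_o$ with $0<c_o<\frac{\sqrt{2\alpha}}{8\,b(q)}$ and every sufficiently large $n$, $$E\,\Phi\big(|L(Z)-\mu_n|\big)\ \ge\ c_o\,\Phi\Big(\frac{\epsilon_o\sqrt{2\alpha n}}{16}\Big).$$
   Context: Let $\mathbb A$ be a finite alphabet, $S:\mathbb A\times\mathbb A\to[0,\infty)$ a pairwise scoring function and $\delta\in\mathbb R$. For $X=(X_1,\dots,X_n),Y=(Y_1,\dots,Y_n)\in\mathbb A^n$, an alignment is a pair $(\rho,\tau)$ of increasing sequences $1\le\rho_1<\dots<\rho_k\le n$, $1\le\tau_1<\dots<\tau_k\le n$ ($k\ge0$), with score $\sum_{i=1}^kS(X_{\rho_i},Y_{\tau_i})+\delta(n-k)$; $L(Z)=L(X,Y)$ is the maximum of this score over all alignments, where $Z=((X_1,Y_1),\dots,(X_n,Y_n))$. Let $(Z_i)_{i\ge1}$, $Z_i=(X_i,Y_i)$, be a stationary aperiodic Markov chain on $\mathbb A\times\mathbb A$ with transition matrix $(p_{\mathbf E\mathbf F})$, some power of which has all entries strictly positive, and $Z=(Z_1,\dots,Z_n)$. Fix $\mathbf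 A,\mathbf B\in\mathbb A\times\mathbb A$ with $P(Z_1=\mathbf A,Z_3=\mathbf B)>0$ and $\mathbf D\in\mathbb A\times\mathbb A$ such that $q:=\frac{p_{\mathbf A\mathbf D}p_{\mathbf D\mathbf B}}{\sum_{\mathbf D'}p_{\mathbf A\mathbf D'}p_{\mathbf D'\mathbf B}}\in(0,1)$. For $z\in(\mathbb A\times\mathbb A)^n$ and $m=\lfloor n/3\rfloor$, let $\mathfrak n_i(z)=1$ if $z_{3i-2}=\mathbf A$ and $z_{3i}=\mathbf B$ and $0$ otherwise ($i=1,\dots,m$), $\mathfrak v(z)=\sum_i\mathfrak n_i(z)$, $\mathfrak u(z)=\sum_i\mathfrak n_i(z)\mathbf 1\{z_{3i-1}=\mathbf D\}$. The random transformation $\mathcal R$ (with randomness independent of $Z$) acts on $z$ with $\mathfrak u(z)<\mathfrak v(z)$ by choosing uniformly at random an index $i$ with $\mathfrak n_i(z)=1$ and $z_{3i-1}\ne\mathbf D$ and replacing $z_{3i-1}$ by $\mathbf D$; if $\mathfrak u(z)=\mathfrak v(z)$ we set $\mathcal R(z)=z$. Assumption (A1): there is a sequence $\Delta_n\to0$ such that $P\big(E[L(\mathcal R(Z))-L(Z)\mid Z]\ge\epsilon_o\big)\ge1-\Delta_n$ for all $n$, where the conditional expectation is over the randomness of $\mathcal R$. *)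

(* Defs.v *)
From HB Require Import structures.
From mathcomp Require Import all_boot all_order all_algebra.
From mathcomp Require Import all_classical all_reals all_analysis.
Set Implicit Arguments. Unset Strict Implicit. Unset Printing Implicit Defensive.
Import Order.TTheory GRing.Theory Num.Theory.
Local Open Scope ring_scope.

Section Defs.
Variables (R : realType) (T : finType).
Local Notation V := (T * T)%type.

(* Score of the alignment given by the pair of index sets (AB.1, AB.2) of equal
   cardinality k: rho = increasing enumeration of AB.1, tau = of AB.2.
   Position i (0-based) of z holds Z_{i+1} = (X_{i+1}, Y_{i+1}). *)
Definition score (S : T -> T -> R) (delta : R) (n : nat) (z : n.-tuple V)
    (AB : {set 'I_n} * {set 'I_n}) : R :=
  \sum_(ij <- zip (enum AB.1) (enum AB.2)) S (tnth z ij.1).1 (tnth z ij.2).2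
  + delta * (n - #|AB.1|)%:R.

(* L(Z): maximal score over all alignments (the empty alignment has score delta*n). *)
Definition Lscore (S : T -> T -> R) (delta : R) (n : nat) (z : n.-tuple V) : R :=
  \big[Order.max/delta * n%:R]_(AB : {set 'I_n} * {set 'I_n} | #|AB.1| == #|AB.2|)
     score S delta z AB.

Fixpoint chain_tail (p : V -> V -> R) (x : V) (s : seq V) : R :=
  if s is y :: s' then p x y * chain_tail p y s' else 1.
Definition law (nu : V -> R) (p : V -> V -> R) (s : seq V) : R :=
  if s is x :: s' then nu x * chain_tail p x s' else 1.

Definition Expect (nu : V -> R) (p : V -> V -> R) (n : nat) (f : n.-tuple V -> R) : R :=
  \sum_(z : n.-tuple V) law nu p z * f z.
Definition Prob (nu : V -> R) (p : V -> V -> R) (n : nat) (E : pred (n.-tuple V)) : R :=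
  \sum_(z : n.-tuple V | E z) law nu p z.

Fixpoint ppow (p : V -> V -> R) (k : nat) : V -> V -> R :=
  if k is k'.+1 then fun E F => \sum_(G : V) ppow p k' E G * p G F
  else fun E F => if E == F then 1 else 0.

(* Blocks: block i (1-based, i = j+1 with j < m = n %/ 3) occupies 0-based
   positions 3j, 3j+1, 3j+2, i.e. 1-based 3i-2, 3i-1, 3i.  The default value
   of nth is irrelevant since all indices used are < n. *)
Definition nblock (a b : V) (n : nat) (z : n.-tuple V) (j : nat) : bool :=
  (nth a z (3 * j) == a) && (nth a z (3 * j).+2 == b).

Definition eligible (a b d : V) (n : nat) (z : n.-tuple V) : seq nat :=
  [seq j <- iota 0 (n %/ 3) | nblock a b z j && (nth a z (3 * j).+1 != d)].

Definition modify (n : nat) (z : n.-tuple V) (k : nat) (d : V) : n.-tuple V :=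
  [tuple (if (i : nat) == k then d else tnth z i) | i < n].

(* E[L(R(z)) - L(z)], expectation over the randomness of R (uniform choice
   among eligible indices; 0 if u(z) = v(z), i.e. no eligible index). *)
Definition Egain (S : T -> T -> R) (delta : R) (a b d : V) (n : nat)
    (z : n.-tuple V) : R :=
  let e := eligible a b d z in
  if e is [::] then 0
  else (size e)%:R^-1 *
       \sum_(j <- e) (Lscore S delta (modify z (3 * j).+1 d) - Lscore S delta z).

Definition pAB (nu : V -> R) (p : V -> V -> R) (a b : V) : R :=
  nu a * \sum_(D' : V) p a D' * p D' b.

Definition qAB (p : V -> V -> R) (a b d : V) : R :=
  p a d * p d b / \sum_(D' : V) p a D' * p D' b.

End Defs.

Definition bq (R : realType) (q : R) : R :=
  Num.sqrt (2 * pi * q * (1 - q)) * expR ((2 * q * (1 - q))^-1).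

(* Main.v *)
Require Import Defs.
From HB Require Import structures.
From mathcomp Require Import all_boot all_order all_algebra.
From mathcomp Require Import all_classical all_reals all_analysis.
From mathcomp Require Import ring lra zify.
Import Order.TTheory GRing.Theory Num.Theory.
Import numFieldNormedType.Exports.
Local Open Scope classical_set_scope.
Local Open Scope ring_scope.
Set Implicit Arguments. Unset Strict Implicit. Unset Printing Implicit Defensive.

(** Let [V] be the number of A?B blocks and [U] the number of those whose middle
    letter is D.  Replacing a non-D middle letter by D multiplies the law by an
    explicit factor, so the random transformation maps the law of [Z] given
    [(U, V) = (u, v)] to its law given [(u + 1, v)]; in particular [U] is
    binomial [(v, q)] given [V = v], in the form of the two-term recursion for
    [w u = P(U = u, V = v)].  Hence the conditional mean [l u] of the score
    satisfies [l (u + 1) - l u = E(gain | u, v)], which is at least [eps] up to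
    an error controlled by the probability of the bad event of (A1), the gain
    being bounded below uniformly in [n].  On the window
    [|u - q v| <= sqrt v / 4], where every [w u] is at least of order
    [P(V = v) / sqrt v], at most about half of the [u] can thus satisfy
    [|l u - mu| < eps sqrt v / 8], and conditional Jensen gives
    [E(Phi |L - mu| ; V = v) >= P(V = v) g Phi (eps sqrt v / 8)].

    No concentration of [V] is needed to conclude: one may assume [Phi 0 = 0], and
    then convexity gives [Phi (eps sqrt v / 8) >= const * (v / n) * Phi x] for
    [v >= alpha n / 2], [x] being the point of the statement, so that only the
    mean of [V], about [alpha n], enters. *)

(** * Mean and variance of weights obeying the binomial recursion *)

Section BinomialWeights.
Variables (R : realType) (q : R) (v : nat) (w : nat -> R).
Hypothesis w_rec : forall u, (u < v)%N ->
  w u.+1 * (u.+1%:R * (1 - q)) = w u * ((v%:R - u%:R) * q).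

Let W := \sum_(0 <= u < v.+1) w u.

(** Stein's identity for the binomial law: the recursion is multiplied by [g u.+1] and summed, the
    boundary terms [u = 0] and [u = v] being zero. The choices [g = 1] and [g u = u] yield the mean
    and the variance. *)
Lemma weights_sum_shift (g : nat -> R) :
  (1 - q) * \sum_(0 <= u < v.+1) w u * (u%:R * g u)
  = q * \sum_(0 <= u < v.+1) w u * ((v%:R - u%:R) * g u.+1).
Proof.
rewrite big_nat_recl // mul0r mulr0 add0r [in RHS]big_nat_recr //=.
rewrite subrr mul0r mulr0 addr0 !mulr_sumr big_nat [RHS]big_nat.
apply: eq_bigr => u /andP[_ uv].
have := w_rec uv => e.
transitivity (w u.+1 * (u.+1%:R * (1 - q)) * g u.+1); first by ring.
by rewrite e; ring.
Qed.

Lemma weights_mean : \sum_(0 <= u < v.+1) w u * u%:R = q * v%:R * W.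
Proof.
have := weights_sum_shift (fun=> 1).
under eq_bigr do rewrite mulr1.
under [in X in _ = X -> _]eq_bigr do rewrite mulr1 mulrBr.
rewrite sumrB -mulr_suml -/W => e.
lra.
Qed.

Lemma weights_variance :
  \sum_(0 <= u < v.+1) w u * (u%:R - q * v%:R) ^+ 2
  = q * (1 - q) * v%:R * W.
Proof.
have := weights_sum_shift (fun u => u%:R).
have := weights_mean.
set S1 := \sum_(0 <= u < v.+1) w u * u%:R => e1.
set S2 := \sum_(0 <= u < v.+1) w u * (u%:R * u%:R).
have -> : \sum_(0 <= u < v.+1) w u * ((v%:R - u%:R) * u.+1%:R)
   = v%:R * S1 + v%:R * W - S2 - S1.
  rewrite /S1 /W /S2 !mulr_sumr -big_split /= -!sumrB.
  by apply: eq_bigr => u _; rewrite -natr1; ring.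
move=> e2.
have -> : \sum_(0 <= u < v.+1) w u * (u%:R - q * v%:R) ^+ 2
   = S2 - 2 * (q * v%:R) * S1 + (q * v%:R) ^+ 2 * W.
  rewrite /S1 /W /S2 !mulr_sumr -sumrB -big_split /=.
  by apply: eq_bigr => u _; ring.
have -> : S2 = q * (v%:R * S1 + v%:R * W - S1) by lra.
by rewrite e1; ring.
Qed.

End BinomialWeights.

(** * Counting integers in a set of bounded diameter *)

Section Counting.
Variable R : realType.

(** The induction discards leading points outside [P]; once the first point of [P] is reached, all
    later ones lie within [Num.truncn D] of it. *)
Lemma count_le_diameter (P : pred nat) (D : R) (u0 k : nat) : 0 <= D ->
  (forall u1 u2, (u0 <= u1)%N -> (u1 <= u2)%N -> (u2 < u0 + k)%N ->
     P u1 -> P u2 -> u2%:R - u1%:R <= D) ->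
  (count P (iota u0 k))%:R <= D + 1.
Proof.
move=> D0; elim: k u0 => [|k IH] u0 HP /=; first by rewrite addr_ge0.
have [Pu|nPu] := boolP (P u0); last first.
  rewrite add0n; apply: IH => u1 u2 h1 h2 h3; apply: HP => //; first exact: ltnW.
  by rewrite addnS -addSn.
have HC : {in iota u0.+1 k, forall u, P u -> (u < u0.+1 + Num.truncn D)%N}.
  move=> u; rewrite mem_iota => /andP[u1 u2] Pu'.
  have := HP u0 u (leqnn _) (ltnW u1); rewrite addnS -addSn => /(_ u2 Pu Pu').
  rewrite -natrB ?(ltnW u1)// => h.
  have : (u - u0 <= Num.truncn D)%N by rewrite truncn_ge_nat.
  by rewrite leq_subLR addSn ltnS.
have le1 : (count P (iota u0.+1 k) <= Num.truncn D)%N.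
  rewrite -size_filter -(size_iota u0.+1 (Num.truncn D)).
  apply: uniq_leq_size; first exact/filter_uniq/iota_uniq.
  move=> u; rewrite mem_filter => /andP[Pu' uI].
  by rewrite mem_iota HC // andbT; move: uI; rewrite mem_iota => /andP[].
by rewrite natrD addrC lerD2r (@le_trans _ _ (Num.truncn D)%:R) ?ler_nat ?truncn_le.
Qed.

End Counting.

(** * The mode of the binomial weights and a lower bound near the mean *)

Lemma expR_le_1Bx (R : realType) (y : R) : 0 <= y <= 2^-1 ->
  expR (- (2 * y)) <= 1 - y.
Proof.
move=> /andP[y0 y1]; rewrite expRN.
have h := expR_ge1Dx (2 * y).
have p : 0 < 1 + 2 * y by lra.
apply: (@le_trans _ _ (1 + 2 * y)^-1).
  by rewrite lef_pV2 // posrE; lra.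
rewrite -[leLHS]mul1r ler_pdivrMr //; nra.
Qed.

Section Mode.
Variables (R : realType) (q : R) (v : nat) (w : nat -> R).
Hypothesis q01 : 0 < q < 1.
Hypothesis w_ge0 : forall u, 0 <= w u.
Hypothesis w_rec : forall u, (u < v)%N ->
  w u.+1 * (u.+1%:R * (1 - q)) = w u * ((v%:R - u%:R) * q).

Let W := \sum_(0 <= u < v.+1) w u.

(** Comparing a maximiser with its two neighbours through the recursion confines it to the interval
    from [q (v + 1) - 1] to [q (v + 1)]. *)
Lemma weights_mode : 0 < W -> exists m, [/\ (m <= v)%N, 0 < w m,
  (forall u, (u <= v)%N -> w u <= w m), q * v%:R - (1 - q) <= m%:R
  & m%:R <= q * v%:R + q].
Proof.
move=> W0; have /andP[q0 q1] := q01.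
have v0 := ler0n R v; have qv0 : 0 <= q * v%:R by rewrite mulr_ge0 // ltW.
have qv1 : 0 <= (1 - q) * v%:R by rewrite mulr_ge0 // subr_ge0 ltW.
have [m _ maxm] := @Order.TotalTheory.arg_maxP _ _ _ (@ord0 v) xpredT
  (fun i : 'I_v.+1 => w i) isT.
have {}maxm u : (u <= v)%N -> w u <= w m.
  by move=> uv; have := maxm (Ordinal (uv : (u < v.+1)%N)) isT.
have wm0 : 0 < w m.
  rewrite lt_neqAle w_ge0 andbT eq_sym; apply/eqP => wm.
  move: W0; rewrite /W big_nat big1 ?ltxx // => u /andP[_ uv].
  by apply/eqP; rewrite eq_le w_ge0 andbT -wm maxm.
have mv : (m <= v)%N by rewrite -ltnS.
exists m; split => //.
- move: mv; rewrite leq_eqVlt => /orP[/eqP ->|mv]; first by lra.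
  have := w_rec mv; have := maxm m.+1 mv.
  rewrite -natr1; move: (w m.+1) (w m) wm0 (m%:R : R) (ler0n R m) => x y y0 t t0 xy e.
  have h : y * ((v%:R - t) * q) <= y * ((t + 1) * (1 - q)).
    by rewrite -e ler_wpM2r // mulr_ge0; lra.
  by move: h; rewrite ler_pM2l //; lra.
- case: (nat_of_ord m) mv wm0 maxm => [|k] mv wm0 maxm.
    by lra.
  have := w_rec mv; have := maxm k (ltnW mv).
  rewrite -natr1; have := ler_nat R k.+1 v; rewrite mv -natr1.
  move: (w k.+1) (w k) wm0 (k%:R : R) (ler0n R k) => y x y0 t t0 tv xy e.
  have h : y * ((t + 1) * (1 - q)) <= y * ((v%:R - t) * q).
    by rewrite e ler_wpM2r // mulr_ge0; lra.
  by move: h; rewrite ler_pM2l //; lra.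
Qed.

(* Chebyshev's inequality at two standard deviations leaves at least 3/4 of the
   mass on an interval of length [4 sg s], where the mode dominates. *)
Lemma weights_mode_lower_bound (m : nat) (sg s : R) :
  0 < sg -> 0 < s -> sg ^+ 2 = q * (1 - q) -> s ^+ 2 = v%:R ->
  (forall u, (u <= v)%N -> w u <= w m) ->
  3 / 4 * W <= (4 * (sg * s) + 1) * w m.
Proof.
move=> sg0 s0 sg2 s2 maxm.
pose P u := `|u%:R - q * v%:R| < 2 * (sg * s).
have dev u : ~~ P u -> 4 * (sg * s) ^+ 2 <= (u%:R - q * v%:R) ^+ 2.
  rewrite /P -leNgt => h.
  rewrite -[leRHS]real_normK ?num_real //.
  rewrite (_ : 4 * (sg * s) ^+ 2 = (2 * (sg * s)) ^+ 2); last by ring.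
  by rewrite ler_pXn2r // ?nnegrE ?normr_ge0 // !mulr_ge0 // ltW.
have ss0 : 0 < (sg * s) ^+ 2 by rewrite exprn_gt0 // mulr_gt0.
have tail : \sum_(0 <= u < v.+1 | ~~ P u) w u <= W / 4.
  have := weights_variance w_rec; rewrite -/W.
  rewrite -sg2 -s2 -exprMn => var.
  rewrite ler_pdivlMr // -(ler_pM2r ss0) -mulrA [leRHS]mulrC -var mulr_suml.
  rewrite [leRHS](bigID P) /= s2 -[leLHS]add0r; apply: lerD.
    by apply: sumr_ge0 => u _; rewrite mulr_ge0 // sqr_ge0.
  by apply: ler_sum => u /dev h; rewrite ler_wpM2l.
have : \sum_(0 <= u < v.+1 | P u) w u <= (4 * (sg * s) + 1) * w m.
  apply: (@le_trans _ _ ((count P (iota 0 v.+1))%:R * w m)).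
    rewrite -big_filter (@le_trans _ _ (\sum_(u <- [seq u <- iota 0 v.+1 | P u]) w m)) //.
      rewrite /index_iota subn0 big_seq [leRHS]big_seq; apply: ler_sum => u.
      by rewrite mem_filter mem_iota => /and3P[_ _ uv]; apply: maxm.
    by rewrite big_const_seq iter_addr_0 count_predT size_filter mulr_natl.
  rewrite ler_wpM2r // count_le_diameter // ?mulr_ge0 // ?ltW // ?mulr_gt0 //.
  move=> u1 u2 _ _ _; rewrite /P !ltr_distl => /andP[? ?] /andP[? ?]; lra.
have : W = \sum_(0 <= u < v.+1 | P u) w u + \sum_(0 <= u < v.+1 | ~~ P u) w u.
  by rewrite /W (bigID P).
lra.
Qed.

(** One step away from the mode inside the window costs at most a factor [1 - y]: the two
    coefficients of the recursion differ by at most [s / 2], the denominator of the ratio of weights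
    is at least [q (1 - q) v], and [y] is the quotient of these bounds. The number of steps is [k],
    to the right or to the left of the mode. *)
Lemma weights_window_decay (m u : nat) (s y : R) :
  4 <= s -> s ^+ 2 = v%:R -> y = (2 * (q * (1 - q)) * s)^-1 -> y <= 1 ->
  q * v%:R - (1 - q) <= m%:R -> m%:R <= q * v%:R + q -> (u <= v)%N -> (m <= v)%N ->
  `|u%:R - q * v%:R| <= s / 4 ->
  exists2 k, k%:R <= s / 4 + 1 & (1 - y) ^+ k * w m <= w u.
Proof.
move=> s4 s2 yE y1 mlo mhi uv mv; rewrite ler_distl => /andP[ulo uhi].
have /andP[q0 q1] := q01.
have qq : 0 < q * (1 - q) by rewrite mulr_gt0 // subr_gt0.
have s0 : 0 < s by lra.
have qs : 0 < 2 * (q * (1 - q)) * s by rewrite !mulr_gt0 ?subr_gt0.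
have yP : y * (2 * (q * (1 - q)) * s) = 1.
  by rewrite yE mulVf // gt_eqF.
have y0 : 0 <= y by rewrite yE invr_ge0 ltW.
have yv : y * (q * (1 - q) * v%:R) = s / 2.
  transitivity (y * (2 * (q * (1 - q)) * s) * s / 2); last by rewrite yP mul1r.
  by rewrite -s2; field.
have v0 : 0 <= (v%:R : R) by rewrite ler0n.
have [mu|um] := leqP m u.
- exists (u - m)%N; first by rewrite natrB //; lra.
  have right k : (m + k <= v)%N -> (m + k)%:R <= q * v%:R + s / 4 ->
      (1 - y) ^+ k * w m <= w (m + k)%N.
    elim: k => [|k IH]; first by rewrite addn0 mul1r.
    rewrite addnS -natr1 => mk mks; rewrite exprS -mulrA.
    have {IH} := IH (ltnW mk) ltac:(lra) => /(ler_wpM2l (_ : 0 <= 1 - y)).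
    rewrite subr_ge0 => /(_ y1) /le_trans; apply.
    have := w_rec mk; rewrite -natr1.
    have mle : (m%:R : R) <= (m + k)%:R by rewrite ler_nat leq_addr.
    move: (w_ge0 (m + k)%N) (w_ge0 (m + k).+1) mks mle.
    set x := w (m + k)%N; set x' := w (m + k).+1; set t : R := (m + k)%:R => x0 x0' ts tm e.
    have t1 : 0 < (t + 1) * (1 - q).
      by rewrite mulr_gt0; nra.
    rewrite -(ler_pM2r t1) e [leLHS](_ : _ = x * ((1 - y) * ((t + 1) * (1 - q)))); last ring.
    rewrite ler_wpM2l //.
    have : y * (q * (1 - q) * v%:R) <= y * ((t + 1) * (1 - q)).
      by rewrite ler_wpM2l //; nra.
    rewrite yv; lra.
  by have := right (u - m)%N; rewrite subnKC // uv; apply.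
- exists (m - u)%N; first by rewrite natrB ?(ltnW um) //; lra.
  have left k : (k <= m)%N -> q * v%:R - s / 4 <= (m - k)%:R ->
      (1 - y) ^+ k * w m <= w (m - k)%N.
    elim: k => [|k IH]; first by rewrite subn0 mul1r.
    move=> km mks; rewrite exprS -mulrA.
    have eS : (m - k)%N = (m - k.+1).+1 by rewrite subnSK.
    have h1 : ((m - k)%:R : R) = (m - k.+1)%:R + 1 by rewrite eS natr1.
    have {IH} := IH (ltnW km) ltac:(lra) => /(ler_wpM2l (_ : 0 <= 1 - y)).
    rewrite subr_ge0 => /(_ y1) /le_trans; apply.
    have lt_v : (m - k.+1 < v)%N by rewrite (leq_trans _ mv) // -eS leq_subr.
    have := w_rec lt_v; rewrite -natr1 -eS.
    have mle : ((m - k)%:R : R) <= m%:R by rewrite ler_nat leq_subr.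
    move: (w_ge0 (m - k)%N) (w_ge0 (m - k.+1)%N) mks mle; rewrite h1.
    set x := w (m - k)%N; set x' := w (m - k.+1)%N; set t : R := (m - k.+1)%:R => x0 x0' ts tm e.
    have t1 : 0 < (v%:R - t) * q by rewrite mulr_gt0; nra.
    rewrite -(ler_pM2r t1) -e [leLHS](_ : _ = x * ((1 - y) * ((v%:R - t) * q))); last ring.
    rewrite ler_wpM2l //.
    have : y * (q * (1 - q) * v%:R) <= y * ((v%:R - t) * q).
      by rewrite ler_wpM2l //; nra.
    rewrite yv; lra.
  by have := left (m - u)%N; rewrite subKn ?(ltnW um) // leq_subr; apply.
Qed.

(** The mode has weight of order [W / (sg s)] by Chebyshev, and about [s / 4] steps of decay cost
    only a constant factor. *)
Lemma weights_window_lower_bound (u : nat) (sg s : R) :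
  0 < sg -> sg ^+ 2 = q * (1 - q) -> s ^+ 2 = v%:R ->
  4 <= s -> 1 <= q * (1 - q) * s -> 2 + 18 * sg <= sg * s -> (u <= v)%N ->
  `|u%:R - q * v%:R| <= s / 4 ->
  W * (expR (- (2 * q * (1 - q))^-1) / (3 * sg)) <= w u * s.
Proof.
move=> sg0 sg2 s2 s4 s_q s_sg uv u_win.
have s0 : 0 < s by lra.
have /andP[q0 q1] := q01.
have qq : 0 < q * (1 - q) by rewrite mulr_gt0 // subr_gt0.
have W_ge0 : 0 <= W by apply: sumr_ge0.
have [<-|W0] : 0 = W \/ 0 < W.
  by move: W_ge0; rewrite le_eqVlt => /orP[/eqP|]; [left|right].
  by rewrite mul0r mulr_ge0 // ltW.
have [m [mv wm0 maxm mlo mhi]] := weights_mode W0.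
pose y := (2 * (q * (1 - q)) * s)^-1.
have qs : 0 < 2 * (q * (1 - q)) * s by rewrite !mulr_gt0 ?subr_gt0.
have yP : y * (2 * (q * (1 - q)) * s) = 1.
  by rewrite /y mulVf // gt_eqF.
have y0 : 0 <= y by rewrite /y invr_ge0 ltW.
have y12 : y <= 2^-1 by nra.
have y1 : y <= 1 by lra.
have [k ks wk] := weights_window_decay s4 s2 erefl y1 mlo mhi uv mv u_win.
have := weights_mode_lower_bound sg0 s0 sg2 s2 maxm => wm.
set i := (q * (1 - q))^-1.
have iP : i * (q * (1 - q)) = 1 by rewrite /i mulVf // gt_eqF.
have i4 : 4 <= i.
  have : q * (1 - q) <= 4^-1 by have := sqr_ge0 (q - 2^-1); nra.
  by move=> h; rewrite /i -[4]invrK lef_pV2 // posrE.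
have -> : (2 * q * (1 - q))^-1 = i / 2 by rewrite /i -mulrA invfM mulrC.
have yi : y * s = i / 2.
  rewrite /y /i; field.
  by rewrite !gt_eqF //; nra.
(* Here [1 - y >= expR (- (2 * y))], and [2 y k <= 2 y (s / 4 + 1) = i / 4 + 2 y] because
   [y s = i / 2]. *)
have pw : expR (- (i / 4 + 2 * y)) <= (1 - y) ^+ k.
  apply: (@le_trans _ _ (expR (- (2 * y)) ^+ k)); last first.
    rewrite lerXn2r // ?nnegrE ?expR_ge0 //; last by rewrite expR_le_1Bx // y0 y12.
    lra.
  rewrite -expRM_natl ler_expR.
  have : y * k%:R <= y * (s / 4 + 1) by rewrite ler_wpM2l.
  lra.
(* The target exponent is [i / 2], so a surplus [i / 4] remains; since [i >= 4] it is worth a factor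
   close to 2, which pays for the crude Chebyshev constant. *)
have ex : 2 * s - 4 <= s * expR (i / 4 - 2 * y).
  apply: (@le_trans _ _ (s * (1 + (i / 4 - 2 * y)))); last first.
    by rewrite ler_pM2l // expR_ge1Dx.
  by nra.
have split_exp : expR (- (i / 4 + 2 * y)) = expR (- (i / 2)) * expR (i / 4 - 2 * y).
  by rewrite -expRD; congr expR; lra.
apply: (@le_trans _ _ (expR (- (i / 4 + 2 * y)) * w m * s)); last first.
  by rewrite ler_pM2r // (le_trans _ wk) // ler_pM2r.
rewrite split_exp.
move: (expR (- _)) (expR_gt0 (- (i / 2))) (expR _) ex => E E0 X ex.
apply: (@le_trans _ _ (E * ((2 * s - 4) * w m))); last first.
  rewrite (_ : E * X * _ * _ = E * ((s * X) * w m)); last ring.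
  by rewrite ler_pM2l // ler_pM2r.
rewrite (_ : W * _ = E * (W / (3 * sg))); last by rewrite mulrCA.
rewrite ler_pM2l // ler_pdivrMr ?mulr_gt0 //.
(* After division by [w m] this is exactly the assumption [2 + 18 * sg <= sg * s]. *)
have : (4 * (sg * s) + 1) * w m <= 3 / 4 * ((2 * s - 4) * w m * (3 * sg)).
  rewrite (_ : 3 / 4 * _ = (3 / 4 * (2 * s - 4) * (3 * sg)) * w m); last ring.
  by rewrite ler_pM2r //; lra.
lra.
Qed.
End Mode.

(** * Partial sums, Jensen's inequality, nearly increasing sequences, fibres *)

Lemma ler_sum_subrange (R : realType) (F : nat -> R) (P : pred nat)
    (n m1 m2 N : nat) :
  (forall u, (n <= u < N)%N -> 0 <= F u) -> (n <= m1)%N -> (m2 <= N)%N ->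
  \sum_(m1 <= u < m2 | P u) F u <= \sum_(n <= u < N) F u.
Proof.
move=> F0 nm m2N; have [m12|m21] := leqP m1 m2; last first.
  by rewrite big_geq ?(ltnW m21) // big_nat sumr_ge0.
rewrite (@big_cat_nat _ _ _ m1 n N) //= ?(leq_trans m12) //.
rewrite (@big_cat_nat _ _ _ m2 m1 N) //=.
rewrite [leLHS](_ : _ = 0 + (\sum_(m1 <= u < m2 | P u) F u + 0)); last first.
  by rewrite addr0 add0r.
apply: lerD; last apply: lerD.
- rewrite big_nat sumr_ge0 // => u /andP[h1 h2]; apply: F0.
  by rewrite h1 (leq_trans h2) // (leq_trans m12).
- rewrite big_mkcond /= big_nat [leRHS]big_nat ler_sum // => u /andP[h1 h2].
  by case: ifP => // _; apply: F0; rewrite (leq_trans nm) // (leq_trans h2).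
- rewrite big_nat sumr_ge0 // => u /andP[h1 h2]; apply: F0.
  by rewrite h2 (leq_trans _ h1) // (leq_trans nm).
Qed.

Section Jensen.
Variables (R : realType) (Phi : R -> R).
Hypothesis Phi_ge0 : forall x, 0 <= x -> 0 <= Phi x.
Hypothesis Phi_conv : forall x y t, 0 <= x -> 0 <= y -> 0 <= t <= 1 ->
  Phi (t * x + (1 - t) * y) <= t * Phi x + (1 - t) * Phi y.

Lemma jensen_sum (I : Type) (r : seq I) (P : pred I) (w x : I -> R) :
  (forall i, 0 <= w i) -> (forall i, 0 <= x i) ->
  0 < \sum_(i <- r | P i) w i ->
  (\sum_(i <- r | P i) w i) *
    Phi ((\sum_(i <- r | P i) w i * x i) / \sum_(i <- r | P i) w i)
  <= \sum_(i <- r | P i) w i * Phi (x i).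
Proof.
move=> w0 x0.
(* The induction also carries the degenerate case, because a tail of the list may have total weight
   zero although the whole list does not. *)
suff [] : (\sum_(i <- r | P i) w i = 0 -> \sum_(i <- r | P i) w i * x i = 0) /\
  (0 < \sum_(i <- r | P i) w i ->
  (\sum_(i <- r | P i) w i) *
    Phi ((\sum_(i <- r | P i) w i * x i) / \sum_(i <- r | P i) w i)
  <= \sum_(i <- r | P i) w i * Phi (x i)) by [].
elim: r => [|i r IH]; first by rewrite !big_nil ltxx.
rewrite !big_cons; case: ifP => // _.
have W0 : 0 <= \sum_(i <- r | P i) w i by rewrite sumr_ge0.
have S0 : 0 <= \sum_(i <- r | P i) w i * x i.
  by rewrite sumr_ge0 // => j _; rewrite mulr_ge0.
have T0 : 0 <= \sum_(i <- r | P i) w i * Phi (x i).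
  by rewrite sumr_ge0 // => j _; rewrite mulr_ge0 // Phi_ge0.
move: (\sum_(i <- r | P i) w i) (\sum_(i <- r | P i) w i * x i)
  (\sum_(i <- r | P i) w i * Phi (x i)) W0 S0 T0 IH => W S T W0 S0 T0 [IH0 IH].
have wi0 := w0 i; have xi0 := x0 i.
split => [e|pos].
  have wi : w i = 0 by lra.
  by rewrite wi mul0r add0r IH0 //; lra.
have [W_eq|W_neq] := eqVneq W 0.
  rewrite IH0 // W_eq !addr0 mulrAC mulfV ?mul1r ?lerDl //.
  by move: pos; rewrite W_eq addr0 => /gt_eqF ->.
have Wp : 0 < W by rewrite lt_neqAle eq_sym W_neq.
have {}IH := IH Wp.
have t01 : 0 <= w i / (w i + W) <= 1.
  by rewrite divr_ge0 ?(ltW pos) //= ler_pdivrMr // mul1r lerDl.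
have := Phi_conv xi0 (divr_ge0 S0 W0) t01.
have -> : w i / (w i + W) * x i + (1 - w i / (w i + W)) * (S / W)
        = (w i * x i + S) / (w i + W).
  by field; rewrite W_neq gt_eqF.
move=> /(ler_wpM2l (ltW pos)) /le_trans; apply.
have -> : (w i + W) *
   (w i / (w i + W) * Phi (x i) + (1 - w i / (w i + W)) * Phi (S / W))
   = w i * Phi (x i) + W * Phi (S / W).
  by field; rewrite gt_eqF.
by rewrite lerD2l.
Qed.

End Jensen.

(** Telescoping between two indices at which [l] is within [x] of [mu] gives
    [eps (u2 - u1) - D <= l u2 - l u1 < 2 x], so such indices form a set of diameter at most
    [(2 x + D) / eps]. *)
Lemma count_close_increasing (R : realType) (l bta : nat -> R) (eps x D mu : R)
    (u0 k : nat) :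
  0 < eps -> 0 <= x -> 0 <= D ->
  (forall u, (u0 <= u < u0 + k)%N -> 0 <= bta u) ->
  (forall u, (u0 <= u)%N -> (u.+1 < u0 + k)%N -> eps - bta u <= l u.+1 - l u) ->
  \sum_(u0 <= u < u0 + k) bta u <= D ->
  (count (fun u => `|l u - mu| < x) (iota u0 k))%:R <= (2 * x + D) / eps + 1.
Proof.
move=> eps0 x0 D0 b0 incr sumb; apply: count_le_diameter.
  by rewrite divr_ge0 ?(ltW eps0) // addr_ge0 // mulr_ge0.
move=> u1 u2 h1 h12 h2; rewrite !ltr_distl => /andP[? ?] /andP[? ?].
rewrite ler_pdivlMr //.
have : \sum_(u1 <= u < u2) (eps - bta u) <= l u2 - l u1.
  rewrite -(telescope_sumr _ h12) big_nat [leRHS]big_nat ler_sum // => u /andP[h3 h4].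
  by apply: incr; [exact: leq_trans h3 | exact: leq_ltn_trans h2].
rewrite sumrB sumr_const_nat -[eps *+ _]mulr_natr natrB //.
have : \sum_(u1 <= u < u2) bta u <= D.
  by apply: le_trans sumb; apply: (@ler_sum_subrange _ _ xpredT) => //; exact: ltnW.
lra.
Qed.

Lemma sum_fibers (R : realType) (Om : finType) (Q : pred Om) (U : Om -> nat)
    (N : nat) (F : Om -> R) :
  (forall z, Q z -> (U z <= N)%N) ->
  \sum_(z | Q z) F z = \sum_(0 <= u < N.+1) \sum_(z | Q z && (U z == u)) F z.
Proof.
move=> UN; rewrite big_mkord.
rewrite (partition_big (fun z => inord (U z) : 'I_N.+1) xpredT) //=.
apply: eq_bigr => u _; apply: eq_bigl => z.
case Qz : (Q z) => //=; apply/eqP/eqP => [<-|e].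
  by rewrite inordK // ltnS UN.
by apply: val_inj; rewrite /= inordK ?e // ltnS -e UN.
Qed.

(** * The lower bound conditionally on the number of blocks *)

Section Fiber.
Variables (R : realType) (Om : finType) (P L G : Om -> R) (Q : pred Om).
Variables (U : Om -> nat) (v : nat) (q eps A mu : R) (Phi : R -> R).
Hypothesis q01 : 0 < q < 1.
Hypothesis eps_gt0 : 0 < eps.
Hypothesis A_ge0 : 0 <= A.
Hypothesis P_ge0 : forall z, 0 <= P z.
Hypothesis U_le : forall z, Q z -> (U z <= v)%N.
Hypothesis G_ge : forall z, - A <= G z.
Hypothesis Phi_ge0 : forall x, 0 <= x -> 0 <= Phi x.
Hypothesis Phi_mono : forall x y, 0 <= x -> x <= y -> Phi x <= Phi y.
Hypothesis Phi_conv : forall x y t, 0 <= x -> 0 <= y -> 0 <= t <= 1 ->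
  Phi (t * x + (1 - t) * y) <= t * Phi x + (1 - t) * Phi y.

Let w u := \sum_(z | Q z && (U z == u)) P z.
Let ell u := \sum_(z | Q z && (U z == u)) P z * L z.
Let W := \sum_(z | Q z) P z.

Hypothesis w_rec : forall u, (u < v)%N ->
  w u.+1 * (u.+1%:R * (1 - q)) = w u * ((v%:R - u%:R) * q).
Hypothesis ell_rec : forall u, (u < v)%N ->
  ell u.+1 * (u.+1%:R * (1 - q)) =
  (\sum_(z | Q z && (U z == u)) P z * (G z + L z)) * ((v%:R - u%:R) * q).

Let bad u := \sum_(z | (Q z && (U z == u)) && (G z < eps)) P z.

Let w_ge0 u : 0 <= w u. Proof. exact: sumr_ge0. Qed.

(** The increment is the mean of [G] on the fibre [u]; [G] is at least [eps] off the bad event and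
    at least [- A] on it, whence the loss [eps + A] per unit of bad mass. *)
Lemma cond_mean_increment (u : nat) : (u < v)%N -> 0 < w u -> 0 < w u.+1 ->
  eps - (eps + A) * (bad u / w u) <= ell u.+1 / w u.+1 - ell u / w u.
Proof.
move=> uv wu wu1; have /andP[q0 q1] := q01.
have gain : eps * w u - (eps + A) * bad u <=
    \sum_(z | Q z && (U z == u)) P z * G z.
  rewrite /w /bad (bigID (fun z => G z < eps) (fun z => Q z && (U z == u))) /=.
  rewrite [leRHS](bigID (fun z => G z < eps)) /=.
  rewrite mulrDr addrAC -mulrBl opprD addrA subrr add0r mulrC [eps * _]mulrC.
  rewrite !mulr_suml; apply: lerD; apply: ler_sum => z /andP[_ Gz].
    by rewrite ler_wpM2l.
  by rewrite ler_wpM2l // leNgt.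
have vu : 0 < (v%:R : R) - u%:R by rewrite subr_gt0 ltr_nat.
(* Dividing [ell_rec] by [w_rec] cancels the combinatorial factors: the mean of [L] on the fibre
   [u.+1] is that of [G + L] on the fibre [u]. *)
have -> : ell u.+1 / w u.+1
   = (\sum_(z | Q z && (U z == u)) P z * (G z + L z)) / w u.
  have := ell_rec uv; have := w_rec uv.
  move: (ell u.+1) (w u) (w u.+1) wu wu1 (\sum_(z | _) _) => e x y x0 y0 g h1 h2.
  have c0 : 0 < (v%:R - u%:R) * q by rewrite mulr_gt0.
  have d0 : 0 < (u.+1%:R : R) * (1 - q) by rewrite mulr_gt0 ?ltr0Sn // subr_gt0.
  apply/eqP; rewrite eqr_div ?(gt_eqF x0) ?(gt_eqF y0) //; apply/eqP.
  apply: (mulIf (lt0r_neq0 d0)); apply: (mulIf (lt0r_neq0 c0)).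
  transitivity ((e * (u.+1%:R * (1 - q))) * (x * ((v%:R - u%:R) * q))); first by ring.
  by rewrite h2 -h1; ring.
rewrite -mulrBl ler_pdivlMr // mulrBl mulrA divfK ?gt_eqF //.
apply: le_trans gain _.
rewrite /ell -sumrB; apply: ler_sum => z _; lra.
Qed.

(** The window holds more than [s / 2 - 1] integers, of which at most [s / 4 + s / 80 + 1] have
    conditional mean close to [mu]. At least [19 / 80 s - 2] remain, which is at least [9 / 40 s]
    once [s >= 160], and each carries mass at least [W h / s]. *)
Lemma fiber_bound (sg s dl h : R) :
  0 < sg -> 0 <= s -> sg ^+ 2 = q * (1 - q) -> s ^+ 2 = v%:R ->
  h = expR (- (2 * q * (1 - q))^-1) / (3 * sg) ->
  160 <= s -> 1 <= q * (1 - q) * s -> 2 + 18 * sg <= sg * s ->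
  0 <= dl -> (eps + A) * dl * 80 <= h * eps ->
  \sum_(z | Q z && (G z < eps)) P z <= dl * W ->
  9 / 40 * h * Phi (eps * s / 8) * W <= \sum_(z | Q z) P z * Phi `|L z - mu|.
Proof.
move=> sg0 s_ge0 sg2 s2 hE s160 s_q s_sg dl0 dl_le badW.
have /andP[q0 q1] := q01.
have s0 : 0 < s by lra.
have h0 : 0 < h by rewrite hE divr_gt0 ?expR_gt0 // mulr_gt0.
have W_ge0 : 0 <= W by apply: sumr_ge0.
have T_ge0 (D : pred Om) : 0 <= \sum_(z | D z) P z * Phi `|L z - mu|.
  by apply: sumr_ge0 => z _; rewrite mulr_ge0 // Phi_ge0.
have [W_eq|W_neq] := eqVneq W 0; first by rewrite W_eq mulr0.
have W0 : 0 < W by rewrite lt_neqAle eq_sym W_neq.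
have WE : W = \sum_(0 <= u < v.+1) w u by apply: sum_fibers.
have v0 : 0 <= (v%:R : R) by rewrite ler0n.
have win_lo : 0 <= q * v%:R - s / 4 by rewrite -s2; nra.
have win_hi : q * v%:R + s / 4 <= v%:R by rewrite -s2; nra.
(* The successor puts [u0] above the left end by at most 1, and [k <= s / 2] keeps the last point
   [u0 + k - 1] below the right end. *)
pose u0 := (Num.truncn (q * v%:R - s / 4)).+1.
pose k := Num.truncn (s / 2).
have /andP[u0_lo u0_hi] : q * v%:R - s / 4 <= u0%:R <= q * v%:R - s / 4 + 1.
  have /andP[h1 h2] := truncn_itv win_lo.
  by rewrite /u0 (ltW h2) /= -natr1 lerD2r.
have /andP[k_hi k_lo] : k%:R <= s / 2 < k%:R + 1.
  by rewrite natr1; apply: truncn_itv; lra.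
have win u : (u0 <= u)%N -> (u < u0 + k)%N -> `|u%:R - q * v%:R| <= s / 4.
  move=> h1 h2; rewrite ler_distl.
  have h3 : (u0%:R : R) <= u%:R by rewrite ler_nat.
  have h4 : (u%:R : R) + 1 <= u0%:R + k%:R by rewrite natr1 -natrD ler_nat.
  by apply/andP; split; lra.
have win_le u : (u0 <= u)%N -> (u < u0 + k)%N -> (u <= v)%N.
  move=> h1 h2; have := win u h1 h2; rewrite ler_distl => /andP[_ h3].
  by rewrite -(ler_nat R); lra.
have w_low u : (u0 <= u)%N -> (u < u0 + k)%N -> W * h <= w u * s.
  move=> h1 h2; rewrite WE hE.
  apply: (weights_window_lower_bound q01 w_ge0 w_rec) => //; first lra.
    exact: win_le.
  exact: win.
have w_pos u : (u0 <= u)%N -> (u < u0 + k)%N -> 0 < w u.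
  move=> h1 h2; rewrite -(pmulr_lgt0 _ s0).
  exact: lt_le_trans (mulr_gt0 W0 h0) (w_low u h1 h2).
pose l u := ell u / w u.
pose bta u := (eps + A) * (bad u / w u).
have epsA : 0 <= eps + A by rewrite addr_ge0 // ltW.
have bad_ge0 u : 0 <= bad u by apply: sumr_ge0.
(* Since [w u >= W h / s] and the bad mass is at most [dl W], the errors add up to at most
   [(eps + A) dl s / h], which the bound on [dl] makes at most [D]. *)
pose D := eps * s / 80.
have bta_sum : \sum_(u0 <= u < u0 + k) bta u <= D.
  apply: (@le_trans _ _ (\sum_(u0 <= u < u0 + k) (eps + A) * (s / (W * h)) * bad u)).
    rewrite big_nat [leRHS]big_nat ler_sum // => u /andP[h1 h2].
    rewrite /bta -mulrA ler_wpM2l // mulrC ler_wpM2r //.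
    have w1 := w_pos u h1 h2.
    rewrite -[leLHS]mul1r ler_pdivrMr // mulrAC ler_pdivlMr ?mulr_gt0 // mul1r mulrC.
    by rewrite mulrC [leRHS]mulrC w_low.
  rewrite -mulr_sumr.
  have : \sum_(u0 <= u < u0 + k) bad u <= dl * W.
    apply: le_trans badW.
    rewrite [leRHS](@sum_fibers _ _ _ U v); last by move=> z /andP[/U_le].
    rewrite [leRHS](eq_bigr bad); last first.
      by move=> u _; apply: eq_bigl => z; rewrite andbAC.
    case E : k => [|k']; first by rewrite addn0 big_geq // sumr_ge0.
    apply: (@ler_sum_subrange _ _ xpredT) => //.
    by rewrite addnS ltnS win_le // ?leq_addr // E addnS.
  move=> /(ler_wpM2l (_ : 0 <= (eps + A) * (s / (W * h)))).
  move=> /(_ (mulr_ge0 epsA (divr_ge0 s_ge0 (mulr_ge0 W_ge0 (ltW h0))))) /le_trans; apply.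
  have -> : (eps + A) * (s / (W * h)) * (dl * W) = (eps + A) * dl * s / h.
    by field; rewrite W_neq gt_eqF.
  rewrite ler_pdivrMr // /D.
  by have := ler_wpM2r s_ge0 dl_le; lra.
pose x := eps * s / 8.
have x0 : 0 <= x by rewrite /x divr_ge0 // mulr_ge0 // ltW.
have far : (count (fun u => `|l u - mu| < x) (iota u0 k))%:R <= (2 * x + D) / eps + 1.
  apply: (@count_close_increasing _ _ bta) => //.
  - by rewrite /D divr_ge0 // mulr_ge0 // ltW.
  - move=> u /andP[h1 h2]; rewrite /bta mulr_ge0 // divr_ge0 //.
  - move=> u h1 h2; apply: cond_mean_increment.
    + by apply: win_le; rewrite // (leq_trans h1).
    + by apply: w_pos => //; apply: ltnW.
    + by apply: w_pos => //; apply: (leq_trans h1).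
have far_count : 9 / 40 * s <= (count (predC (fun u => `|l u - mu| < x)) (iota u0 k))%:R.
  have := count_predC (fun u => `|l u - mu| < x) (iota u0 k).
  rewrite size_iota => /(congr1 (fun n => n%:R : R)); rewrite natrD.
  have : (2 * x + D) / eps = s / 4 + s / 80.
    by rewrite /x /D; field; rewrite gt_eqF.
  lra.
have Phix := Phi_ge0 x0.
rewrite (@sum_fibers _ _ _ U v) //.
apply: (@le_trans _ _ (\sum_(u0 <= u < u0 + k | ~~ (`|l u - mu| < x))
   \sum_(z | Q z && (U z == u)) P z * Phi `|L z - mu|)); last first.
  case E : k => [|k']; first by rewrite addn0 big_geq // sumr_ge0.
  apply: ler_sum_subrange => //.
  by rewrite addnS ltnS win_le // ?leq_addr // E addnS.
apply: (@le_trans _ _ (\sum_(u0 <= u < u0 + k | ~~ (`|l u - mu| < x))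
   (W * h / s * Phi x))).
  rewrite -big_filter big_const_seq count_predT size_filter iter_addr_0.
  rewrite /index_iota addKn -[leRHS]mulr_natl.
  move: far_count; rewrite /= => /(ler_wpM2r (_ : 0 <= W * h / s * Phi x)).
  move=> /(_ (mulr_ge0 (divr_ge0 (mulr_ge0 W_ge0 (ltW h0)) s_ge0) Phix)).
  move=> H; apply: le_trans H; rewrite le_eqVlt; apply/orP; left; apply/eqP.
  by rewrite /x; field; rewrite gt_eqF.
rewrite big_nat_cond [leRHS]big_nat_cond; apply: ler_sum => u /andP[/andP[h1 h2]].
rewrite -leNgt => far_u.
have wu := w_pos u h1 h2.
(* Jensen on the fibre [u] bounds the mean of [Phi] from below by [Phi] at the mean of [|L - mu|],
   and that mean is at least [|l u - mu| >= x]. *)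
have := @jensen_sum _ _ Phi_ge0 Phi_conv _ (index_enum Om)
  (fun z => Q z && (U z == u)) P (fun z => `|L z - mu|) P_ge0 (fun=> normr_ge0 _) wu.
move=> H; apply: le_trans H; rewrite -/(w u).
apply: ler_pM => //; first by rewrite divr_ge0 // mulr_ge0 // ltW.
  by rewrite ler_pdivrMr // w_low.
apply: Phi_mono => //; apply: le_trans far_u _.
have -> : l u - mu = (\sum_(z | Q z && (U z == u)) P z * (L z - mu)) / w u.
  under eq_bigr do rewrite mulrBr.
  by rewrite sumrB -mulr_suml -/(w u) mulrBl [w u * mu]mulrC mulfK ?gt_eqF.
rewrite normrM normfV (gtr0_norm wu) ler_pM2r ?invr_gt0 //.
apply: le_trans (ler_norm_sum _ _ _) _; apply: ler_sum => z _.
by rewrite normrM (ger0_norm (P_ge0 z)).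
Qed.

End Fiber.

(** * Changing one letter of a word *)

Section Modify.
Variables (T : finType) (n : nat).
Local Notation V := (T * T)%type.
Implicit Types (z : n.-tuple V) (x y : V).

Lemma nth_modify z (k i : nat) x y : (k < n)%N ->
  nth y (modify z k x) i = if i == k then x else nth y z i.
Proof.
move=> kn; have [i_lt|i_ge] := ltnP i n.
  rewrite -[i]/(val (Ordinal i_lt)) -tnth_nth tnth_mktuple /=.
  by case: eqP => // _; rewrite (tnth_nth y).
rewrite !nth_default ?size_tuple //; case: eqP => // e.
by move: i_ge; rewrite e leqNgt kn.
Qed.

Lemma eq_tuple_nth z1 z2 (y : V) :
  (forall i, nth y z1 i = nth y z2 i) -> z1 = z2.
Proof. by move=> e; apply: eq_from_tnth => i; rewrite !(tnth_nth y). Qed.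

Lemma modify_modify z (k : nat) x y : (k < n)%N ->
  modify (modify z k x) k y = modify z k y.
Proof.
move=> kn; apply: (@eq_tuple_nth _ _ x) => i.
by rewrite !nth_modify //; case: eqP.
Qed.

Lemma modify_id z (k : nat) x y : (k < n)%N -> nth x z k = y -> modify z k y = z.
Proof.
move=> kn e; apply: (@eq_tuple_nth _ _ x) => i.
by rewrite !nth_modify //; case: eqP => // ->.
Qed.

End Modify.

(** * Effect of one letter on the score, uniformly in the length *)

Section Lipschitz.
Variables (R : realType) (T : finType) (S : T -> T -> R) (delta : R).
Hypothesis S_ge0 : forall x y, 0 <= S x y.
Local Notation V := (T * T)%type.
Let M := \sum_x \sum_y S x y.

Let M_ge0 : 0 <= M. Proof. by apply: sumr_ge0 => x _; apply: sumr_ge0. Qed.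

Let S_le x y : S x y <= M.
Proof.
rewrite /M (bigD1 x) //= (bigD1 y) //= -addrA lerDl addr_ge0 ?sumr_ge0 //.
by move=> i _; apply: sumr_ge0.
Qed.

Lemma sum_eq_index_le1 (n : nat) (s : seq 'I_n) (k : nat) : uniq s ->
  \sum_(i <- s) ((i : nat) == k)%:R <= 1 :> R.
Proof.
move=> us.
have -> : \sum_(i <- s) ((i : nat) == k)%:R = (count_mem k (map val s))%:R :> R.
  elim: s {us} => [|i s IH]; first by rewrite big_nil.
  by rewrite big_cons IH /= natrD.
by rewrite count_uniq_mem ?(map_inj_uniq val_inj) // lern1 leq_b1.
Qed.

(** Position [k] enters at most one aligned pair through each of the two sequences, and since scores
    lie between 0 and [M] each affected term drops by at most [M]. *)
Lemma score_modify (n : nat) (z : n.-tuple V) (k : nat) (d : V)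
    (AB : {set 'I_n} * {set 'I_n}) : #|AB.1| == #|AB.2| ->
  score S delta z AB - 2 * M <= score S delta (modify z k d) AB.
Proof.
move=> /eqP cardAB; rewrite /score addrAC lerD2r lerBlDr.
set r := zip _ _.
have szE : size (enum AB.1) = size (enum AB.2) by rewrite -!cardE.
have term (ij : 'I_n * 'I_n) : S (tnth z ij.1).1 (tnth z ij.2).2 <=
    S (tnth (modify z k d) ij.1).1 (tnth (modify z k d) ij.2).2
    + (((ij.1 : nat) == k)%:R * M + ((ij.2 : nat) == k)%:R * M).
  rewrite !tnth_mktuple; case: eqP => _; case: eqP => _;
    rewrite ?mul1r ?mul0r ?addr0 ?add0r //.
  - by rewrite (le_trans (S_le _ _)) // addrA lerDr addr_ge0.
  - by rewrite (le_trans (S_le _ _)) // lerDr.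
  - by rewrite (le_trans (S_le _ _)) // lerDr.
apply: le_trans (ler_sum _ (fun ij _ => term ij)) _.
rewrite !big_split /= lerD2l -!mulr_suml.
rewrite mulrDl mul1r lerD // -[leRHS]mul1r ler_wpM2r //.
- rewrite -(big_map fst xpredT (fun i : 'I_n => ((i : nat) == k)%:R)).
  by rewrite -/(unzip1 r) unzip1_zip ?szE // sum_eq_index_le1 // enum_uniq.
- rewrite -(big_map snd xpredT (fun i : 'I_n => ((i : nat) == k)%:R)).
  by rewrite -/(unzip2 r) unzip2_zip ?szE // sum_eq_index_le1 // enum_uniq.
Qed.

Lemma Lscore_modify (n : nat) (z : n.-tuple V) (k : nat) (d : V) :
  - (2 * M) <= Lscore S delta (modify z k d) - Lscore S delta z.
Proof.
rewrite lerBrDl -lerBrDr opprK; apply: bigmax_le => [|AB cAB].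
  apply: (@le_trans _ _ (Lscore S delta (modify z k d))); first exact: bigmax_ge_id.
  by rewrite lerDl mulr_ge0.
rewrite -lerBlDr; apply: le_trans (score_modify z k d cAB) _.
exact: (le_bigmax_cond _ (score S delta (modify z k d)) cAB).
Qed.

(** This bound, free of [n], limits the damage done on the bad event of (A1); it becomes the
    constant [A] of the fibre estimate. *)
Lemma Egain_ge (a b d : V) (n : nat) (z : n.-tuple V) :
  - (2 * M) <= Egain S delta a b d z.
Proof.
rewrite /Egain; case: (eligible a b d z) => [|j e].
  by rewrite oppr_le0 mulr_ge0.
rewrite [leRHS]mulrC ler_pdivlMr ?ltr0Sn // mulr_natr.
rewrite -[size _]count_predT -iter_addr_0 -big_const_seq.
by apply: ler_sum => i _; exact: Lscore_modify.
Qed.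

End Lipschitz.

(** * Block statistics and their behaviour under a change of a middle letter *)

Lemma count_uniq_split (P : pred nat) (s : seq nat) (j : nat) : uniq s -> j \in s ->
  count P s = (P j + count (fun i => (i != j) && P i) s)%N.
Proof.
move=> us js; rewrite -!sum1_count big_mkcond (bigD1_seq j) //=.
by congr addn; rewrite ?big_mkcondr //; case: ifP.
Qed.

Section Blocks.
Variables (T : finType) (a b d : T * T) (n : nat).
Local Notation V := (T * T)%type.
Implicit Types (z : n.-tuple V) (x y : V).

Definition midD z (j : nat) : bool := nth a z (3 * j).+1 == d.

(** The statistic $\mathfrak v$; [dblocks] is $\mathfrak u$. *)
Definition nblocks z : nat := count (nblock a b z) (iota 0 (n %/ 3)).

Definition dblocks z : nat :=
  count (fun j => nblock a b z j && midD z j) (iota 0 (n %/ 3)).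

Lemma block_lt (j : nat) : j \in iota 0 (n %/ 3) -> ((3 * j).+2 < n)%N.
Proof. rewrite mem_iota; lia. Qed.

(** [nblock] reads only positions congruent to 0 or 2 modulo 3, whereas middle letters sit at
    positions congruent to 1. *)
Lemma nblock_modify z (j i : nat) x : ((3 * j).+1 < n)%N ->
  nblock a b (modify z (3 * j).+1 x) i = nblock a b z i.
Proof.
move=> jn; rewrite /nblock !nth_modify //.
by rewrite !ifF //; apply/eqP; lia.
Qed.

Lemma midD_modify z (j i : nat) x : ((3 * j).+1 < n)%N ->
  midD (modify z (3 * j).+1 x) i = if i == j then x == d else midD z i.
Proof.
move=> jn; rewrite /midD nth_modify //.
by rewrite eqSS eqn_pmul2l //; case: (i == j).
Qed.

Lemma nblocks_modify z (j : nat) x : ((3 * j).+1 < n)%N ->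
  nblocks (modify z (3 * j).+1 x) = nblocks z.
Proof. by move=> jn; apply: eq_count => i; rewrite nblock_modify. Qed.

Lemma dblocks_modify z (j : nat) x : j \in iota 0 (n %/ 3) ->
  nblock a b z j -> midD z j -> x != d ->
  dblocks z = (dblocks (modify z (3 * j).+1 x)).+1.
Proof.
move=> jI nbj mj /negPf xd; have jn := ltnW (block_lt jI).
rewrite /dblocks [LHS](count_uniq_split _ (iota_uniq _ _) jI) nbj mj.
rewrite [in RHS](count_uniq_split _ (iota_uniq _ _) jI).
rewrite nblock_modify // nbj midD_modify // eqxx xd add0n add1n; congr S.
apply: eq_count => i; rewrite nblock_modify // midD_modify //.
by case: eqP.
Qed.

Lemma nblocksE z : nblocks z = (dblocks z + size (eligible a b d z))%N.
Proof.
rewrite /nblocks /dblocks /eligible size_filter.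
elim: (iota _ _) => //= j s ->; rewrite /midD.
by case: (nblock a b z j) => //=; case: eqP => //= _; lia.
Qed.

Lemma nblocks_le z : (nblocks z <= n %/ 3)%N.
Proof. by rewrite /nblocks (leq_trans (count_size _ _)) // size_iota. Qed.

Lemma tuple_block z (j : nat) x : ((3 * j).+2 < n)%N -> nblock a b z j ->
  modify z (3 * j).+1 x = take (3 * j) z ++ [:: a, x, b & drop (3 * j).+3 z] :> seq V.
Proof.
move=> jn /andP[/eqP za /eqP zb].
have sz : size (take (3 * j) z) = (3 * j)%N by rewrite size_take size_tuple; case: ifP; lia.
apply: (@eq_from_nth _ a).
  by rewrite size_tuple size_cat sz /= size_drop size_tuple; lia.
move=> i _; rewrite nth_modify ?(ltnW jn) // nth_cat sz.
case: ltnP => i3; first by rewrite nth_take // ifF //; apply/eqP; lia.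
move: i3 => /subnKC <-; move: (i - 3 * j)%N => {}i; rewrite addKn.
case: i => [|[|[|i]]] /=; rewrite ?addn0 ?addn1 ?addn2 ?eqxx //.
- by rewrite ifF //; apply/eqP; lia.
- by rewrite ifF //; apply/eqP; lia.
- by rewrite nth_drop ifF; [congr nth; lia | apply/eqP; lia].
Qed.

End Blocks.

(** * Transport of the law by the random transformation *)

Section Transport.
Variables (R : realType) (T : finType) (nu : T * T -> R) (p : T * T -> T * T -> R).
Variables (a b d : T * T) (n : nat).
Local Notation V := (T * T)%type.
Local Notation q := (qAB p a b d).
Hypothesis q01 : 0 < q < 1.

(** Only two transitions involve the middle letter, so everything else goes into a factor [K]
    independent of [x]. *)
Lemma chain_tail_block (y : V) (s1 s2 : seq V) :
  exists K, forall x, chain_tail p y (s1 ++ [:: a, x, b & s2]) = K * (p a x * p x b).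
Proof.
elim: s1 y => [|x0 s1 IH] y /=.
  by exists (p y a * chain_tail p b s2) => x; ring.
by have [K HK] := IH x0; exists (p y x0 * K) => x; rewrite HK mulrA.
Qed.

Lemma law_block (s1 s2 : seq V) :
  exists K, forall x, law nu p (s1 ++ [:: a, x, b & s2]) = K * (p a x * p x b).
Proof.
case: s1 => [|x0 s1] /=.
  by exists (nu a * chain_tail p b s2) => x; ring.
by have [K HK] := chain_tail_block x0 s1 s2; exists (nu x0 * K) => x; rewrite HK mulrA.
Qed.

Lemma law_modify (z : n.-tuple V) (j : nat) (x y : V) :
  ((3 * j).+2 < n)%N -> nblock a b z j ->
  law nu p (modify z (3 * j).+1 x) * (p a y * p y b)
  = law nu p (modify z (3 * j).+1 y) * (p a x * p x b).
Proof.
move=> jn zj; rewrite !(tuple_block _ jn zj).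
have [K HK] := law_block (take (3 * j) z) (drop (3 * j).+3 z).
by rewrite !HK; ring.
Qed.

(** With all letters but the middle one of block [j] fixed, the letters other than [d] carry
    together [(1 - q) / q] times the mass of [d], and [f] is evaluated at the same word on both
    sides. *)
Lemma resample_block (j u v : nat) (f : n.-tuple V -> R) :
  j \in iota 0 (n %/ 3) ->
  (\sum_(z : n.-tuple V | ((nblocks a b z == v) && (dblocks a b d z == u)) &&
       (nblock a b z j && ~~ midD a d z j))
     law nu p z * f (modify z (3 * j).+1 d)) * q
  = (\sum_(z : n.-tuple V | ((nblocks a b z == v) && (dblocks a b d z == u.+1)) &&
       (nblock a b z j && midD a d z j)) law nu p z * f z) * (1 - q).
Proof.
move=> jI; have jn := block_lt jI; have jn1 := ltnW jn.
set k := (3 * j).+1.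
(* A word with a middle letter other than [d] is encoded by the word with [d] put there, paired with
   the letter removed. *)
rewrite (reindex_onto (fun y : n.-tuple V * V => modify y.1 k y.2)
  (fun z => (modify z k d, nth a z k))); last first.
  by move=> z _ /=; rewrite modify_modify // (modify_id jn1 erefl).
set P' : pred (n.-tuple V) := fun z => ((nblocks a b z == v) && (dblocks a b d z == u.+1)) &&
       (nblock a b z j && midD a d z j).
rewrite (eq_bigl (fun y => P' y.1 && (y.2 != d))); last first.
  case=> z x /=; rewrite modify_modify // nth_modify // eqxx xpair_eqE eqxx andbT.
  rewrite nblocks_modify // nblock_modify // midD_modify // eqxx.
  have [mz|nmz] := boolP (midD a d z j); last first.
    rewrite /P' (negPf nmz) !andbF /=; apply/negP => /andP[_ /eqP e].
    by move: nmz; rewrite -e midD_modify // !eqxx.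
  rewrite (modify_id jn1 (eqP mz)) eqxx andbT /P' mz andbT.
  case nz : (nblock a b z j); last by rewrite !andbF.
  have [->|xd] := eqVneq x d; first by rewrite !andbF.
  by rewrite (dblocks_modify jI nz mz xd) eqSS !andbT.
rewrite -(pair_big P' (fun x => x != d) (fun z x => law nu p (modify z k x) *
   f (modify (modify z k x) k d))) /= !mulr_suml.
apply: eq_bigr => z /andP[_ /andP[nz mz]].
under eq_bigr do rewrite modify_modify // (modify_id jn1 (eqP mz)).
rewrite -mulr_suml.
set Z := \sum_x p a x * p x b.
have /andP[q0 q1] := q01.
have qE : q = p a d * p d b / Z by [].
have Z0 : Z != 0.
  by apply/eqP => Z0; move: q0; rewrite qE Z0 invr0 mulr0 ltxx.
have qZ : q * Z = p a d * p d b by rewrite qE divfK.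
have pd0 : p a d * p d b != 0 by rewrite -qZ mulf_neq0 // gt_eqF.
have ZE : Z = p a d * p d b + \sum_(x | x != d) p a x * p x b by rewrite /Z (bigD1 d).
have key : (\sum_(x | x != d) law nu p (modify z k x)) * (p a d * p d b)
   = law nu p z * \sum_(x | x != d) p a x * p x b.
  rewrite mulr_suml mulr_sumr; apply: eq_bigr => x _.
  by rewrite law_modify // (modify_id jn1 (eqP mz)).
apply: (mulIf pd0).
rewrite (_ : _ * f z * q * _ =
  ((\sum_(x | x != d) law nu p (modify z k x)) * (p a d * p d b)) * f z * q); last ring.
rewrite key (_ : \sum_(x | x != d) _ = Z - p a d * p d b); last by rewrite ZE; ring.
by rewrite -qZ; ring.
Qed.

(** [resample_block] summed over [j]: the left side collects the eligible blocks, and on the right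
    each word is counted once for each of its [u.+1] blocks with middle letter [d]. With [f = 1]
    this is the binomial recursion, with [f] the score the recursion for the conditional means. *)
Lemma law_transport (u v : nat) (f : n.-tuple V -> R) :
  (\sum_(z : n.-tuple V | (nblocks a b z == v) && (dblocks a b d z == u))
     law nu p z * \sum_(j <- eligible a b d z) f (modify z (3 * j).+1 d)) * q
  = (\sum_(z : n.-tuple V | (nblocks a b z == v) && (dblocks a b d z == u.+1))
      law nu p z * f z) * (u.+1%:R * (1 - q)).
Proof.
transitivity (\sum_(j <- iota 0 (n %/ 3))
  (\sum_(z : n.-tuple V | ((nblocks a b z == v) && (dblocks a b d z == u)) &&
       (nblock a b z j && ~~ midD a d z j))
     law nu p z * f (modify z (3 * j).+1 d)) * q).
  rewrite -mulr_suml; congr (_ * _).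
  under eq_bigr do rewrite /eligible big_filter mulr_sumr.
  by rewrite (exchange_big_dep xpredT).
rewrite big_seq.
under eq_bigr do rewrite resample_block //.
rewrite -big_seq -mulr_suml mulrA; congr (_ * _).
transitivity (\sum_(z : n.-tuple V | (nblocks a b z == v) && (dblocks a b d z == u.+1))
   \sum_(j <- iota 0 (n %/ 3) | nblock a b z j && midD a d z j) law nu p z * f z).
  by rewrite [RHS](exchange_big_dep xpredT).
rewrite mulr_suml; apply: eq_bigr => z /andP[_ /eqP <-].
by rewrite big_const_seq iter_addr_0 mulr_natr.
Qed.

End Transport.

(** * Marginals of the stationary chain and the mean number of blocks *)

Lemma sum_tuple_cons (R : realType) (A : finType) (n : nat) (F : seq A -> R) :
  \sum_(z : n.+1.-tuple A) F z = \sum_x \sum_(t : n.-tuple A) F (x :: t).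
Proof.
rewrite pair_big /= (reindex (fun y : A * n.-tuple A => cons_tuple y.1 y.2)) //=.
exists (fun z => (thead z, behead_tuple z)) => [[x t]|z] _ /=.
  by rewrite theadE; congr pair; apply: val_inj.
by rewrite [z in RHS]tuple_eta; apply: val_inj.
Qed.

Lemma sum_tuple0 (R : realType) (A : finType) (F : seq A -> R) :
  \sum_(z : 0.-tuple A) F z = F [::].
Proof.
rewrite (bigD1 [tuple]) //= big1 ?addr0 // => z.
by rewrite tuple0 => /eqP.
Qed.

Section ChainLaw.
Variables (R : realType) (T : finType).
Local Notation V := (T * T)%type.
Variables (nu : V -> R) (p : V -> V -> R).
Hypothesis Hp0 : forall E F, 0 <= p E F.
Hypothesis Hp1 : forall E, \sum_(F : V) p E F = 1.
Hypothesis Hnu0 : forall E, 0 <= nu E.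
Hypothesis Hnu1 : \sum_(E : V) nu E = 1.
Hypothesis Hstat : forall F, \sum_(E : V) nu E * p E F = nu F.

Lemma law_ge0 (s : seq V) : 0 <= law nu p s.
Proof.
have tail_ge0 x s' : 0 <= chain_tail p x s'.
  by elim: s' x => [|y s' IH] x //=; rewrite mulr_ge0.
by case: s => [|x s] //=; rewrite mulr_ge0.
Qed.

Lemma sum_chain_tail (n : nat) (x : V) : \sum_(t : n.-tuple V) chain_tail p x t = 1.
Proof.
elim: n x => [|n IH] x; first by rewrite sum_tuple0.
rewrite sum_tuple_cons /= -[RHS](Hp1 x); apply: eq_bigr => y _.
by rewrite -mulr_sumr IH mulr1.
Qed.

Lemma sum_law (n : nat) : \sum_(z : n.-tuple V) law nu p z = 1.
Proof.
case: n => [|n]; first by rewrite sum_tuple0.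
rewrite sum_tuple_cons /= -[RHS]Hnu1; apply: eq_bigr => y _.
by rewrite -mulr_sumr sum_chain_tail mulr1.
Qed.

(** Summing out the first letter turns the initial law [nu] into its image under [p], which is [nu]
    again by stationarity. *)
Lemma law_behead (n : nat) (G : seq V -> R) :
  \sum_(z : n.+1.-tuple V) law nu p z * G (behead z)
  = \sum_(t : n.-tuple V) law nu p t * G t.
Proof.
rewrite (sum_tuple_cons _ (fun s => law nu p s * G (behead s))) /=.
case: n => [|n].
  rewrite (sum_tuple0 (fun s => law nu p s * G s)) /= mul1r.
  rewrite -[RHS]mul1r -Hnu1 mulr_suml; apply: eq_bigr => x _.
  by rewrite (sum_tuple0 (fun s => nu x * chain_tail p x s * G s)) /= mulr1.
rewrite (sum_tuple_cons _ (fun s => law nu p s * G s)) /=.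
under eq_bigr => x _ do
  rewrite (sum_tuple_cons _ (fun s => nu x * chain_tail p x s * G s)) /=.
rewrite exchange_big /=; apply: eq_bigr => y _.
rewrite exchange_big /=; apply: eq_bigr => t _.
rewrite -(Hstat y) !mulr_suml; apply: eq_bigr => x _; ring.
Qed.

Lemma law_drop (k n : nat) (G : seq V -> R) :
  \sum_(z : (k + n).-tuple V) law nu p z * G (drop k z)
  = \sum_(t : n.-tuple V) law nu p t * G t.
Proof.
elim: k => [|k IH]; first by under eq_bigr do rewrite drop0.
rewrite -IH -(law_behead _ (fun s => G (drop k s))).
by apply: eq_bigr => z _; rewrite -drop1 drop_drop addn1.
Qed.

Lemma law_block_prob (a b : V) (n : nat) :
  \sum_(t : n.+3.-tuple V) law nu p t * ((nth a t 0 == a) && (nth a t 2 == b))%:R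
  = pAB nu p a b.
Proof.
rewrite (sum_tuple_cons _
  (fun s => law nu p s * ((nth a s 0 == a) && (nth a s 2 == b))%:R)) /=.
rewrite (bigD1 a) //= [X in _ + X]big1 ?addr0; last first.
  by move=> x /negPf ->; rewrite big1 // => t _; rewrite mulr0.
rewrite eqxx (sum_tuple_cons _
  (fun s => nu a * chain_tail p a s * (true && (nth a s 1 == b))%:R)) /=.
rewrite /pAB mulr_sumr; apply: eq_bigr => x _.
rewrite (sum_tuple_cons _
  (fun s => nu a * (p a x * chain_tail p x s) * (nth a s 0 == b)%:R)) /=.
rewrite (bigD1 b) //= [X in _ + X]big1 ?addr0; last first.
  by move=> y /negPf ->; rewrite big1 // => t _; rewrite mulr0.
transitivity (nu a * (p a x * p x b) * \sum_(t : n.-tuple V) chain_tail p b t).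
  by rewrite mulr_sumr eqxx; apply: eq_bigr => t _; rewrite /= mulr1; ring.
by rewrite sum_chain_tail mulr1.
Qed.

(** Linearity of the expectation; [law_drop] shifts block [j] to the origin, where its probability
    is [pAB]. *)
Lemma expect_nblocks (a b : V) (n : nat) :
  \sum_(z : n.-tuple V) law nu p z * (nblocks a b z)%:R
  = (n %/ 3)%:R * pAB nu p a b.
Proof.
transitivity (\sum_(j <- iota 0 (n %/ 3)) pAB nu p a b); last first.
  by rewrite big_const_seq count_predT iter_addr_0 size_iota mulr_natl.
transitivity (\sum_(z : n.-tuple V) \sum_(j <- iota 0 (n %/ 3))
   law nu p z * (nblock a b z j)%:R).
  apply: eq_bigr => z _; rewrite -mulr_sumr /nblocks; congr (_ * _).
  by elim: (iota _ _) => [|j s IH]; rewrite ?big_nil // big_cons -IH -natrD.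
rewrite exchange_big /= big_seq [RHS]big_seq; apply: eq_bigr => j jI.
have [m e] : exists m, n = (3 * j + m.+3)%N.
  by exists (n - 3 * j - 3)%N; have := block_lt jI; lia.
move: jI => _; subst n.
rewrite -(law_block_prob a b m) -(law_drop (3 * j)
   _ (fun s => ((nth a s 0 == a) && (nth a s 2 == b))%:R)).
by apply: eq_bigr => z _; rewrite /nblock !nth_drop addn0 addn2.
Qed.

Lemma pAB_le1 (a b : V) : pAB nu p a b <= 1.
Proof.
apply: (@le_trans _ _ (\sum_(t : 3.-tuple V) law nu p t)); last by rewrite sum_law.
rewrite -(law_block_prob a b 0); apply: ler_sum => t _.
by rewrite -[leRHS]mulr1 ler_wpM2l ?law_ge0 // lern1 leq_b1.
Qed.

End ChainLaw.

(** * Application to the score, summation over the number of blocks, constants *)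

Section Assembly.
Variables (R : realType) (T : finType) (S : T -> T -> R) (delta : R).
Local Notation V := (T * T)%type.
Variables (nu : V -> R) (p : V -> V -> R) (a b d : V) (Phi : R -> R) (eps : R).
Hypothesis HS : forall x y, 0 <= S x y.
Hypothesis Hp0 : forall E F, 0 <= p E F.
Hypothesis Hp1 : forall E, \sum_(F : V) p E F = 1.
Hypothesis Hnu0 : forall E, 0 <= nu E.
Hypothesis Hnu1 : \sum_(E : V) nu E = 1.
Hypothesis Hstat : forall F, \sum_(E : V) nu E * p E F = nu F.
Hypothesis HAB : 0 < pAB nu p a b.
Hypothesis Hq : 0 < qAB p a b d < 1.
Hypothesis Phi_ge0 : forall x, 0 <= x -> 0 <= Phi x.
Hypothesis Phi_mono : forall x y, 0 <= x -> x <= y -> Phi x <= Phi y.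
Hypothesis Phi_conv : forall x y t, 0 <= x -> 0 <= y -> 0 <= t <= 1 ->
  Phi (t * x + (1 - t) * y) <= t * Phi x + (1 - t) * Phi y.
Hypothesis Heps : 0 < eps.

Local Notation q := (qAB p a b d).
Let sg := Num.sqrt (q * (1 - q)).
Let h := expR (- (2 * q * (1 - q))^-1) / (3 * sg).
Let A := 2 * \sum_x \sum_y S x y.

Let qq_gt0 : 0 < q * (1 - q).
Proof. by have /andP[q0 q1] := Hq; rewrite mulr_gt0 // subr_gt0. Qed.

Let sg_gt0 : 0 < sg. Proof. by rewrite sqrtr_gt0. Qed.

Let sg2 : sg ^+ 2 = q * (1 - q). Proof. by rewrite sqr_sqrtr // ltW. Qed.

Lemma blocks_bound (n v : nat) (mu s dl : R) :
  0 <= s -> s ^+ 2 = v%:R ->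
  160 <= s -> 1 <= q * (1 - q) * s -> 2 + 18 * sg <= sg * s ->
  0 <= dl -> (eps + A) * dl * 80 <= h * eps ->
  \sum_(z : n.-tuple V | (nblocks a b z == v) && (Egain S delta a b d z < eps))
    law nu p z <= dl * \sum_(z : n.-tuple V | nblocks a b z == v) law nu p z ->
  9 / 40 * h * Phi (eps * s / 8) * \sum_(z : n.-tuple V | nblocks a b z == v) law nu p z
  <= \sum_(z : n.-tuple V | nblocks a b z == v)
       law nu p z * Phi `|Lscore S delta z - mu|.
Proof.
move=> s0 s2 s160 s_q s_sg dl0 dl_le bad_le.
have szE u (z : n.-tuple V) : (nblocks a b z == v) && (dblocks a b d z == u) ->
    (size (eligible a b d z))%:R = v%:R - u%:R :> R.
  by move=> /andP[/eqP <- /eqP <-]; rewrite (nblocksE a b d) natrD addrC addKr.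
have A0 : 0 <= A.
  by rewrite mulr_ge0 // sumr_ge0 // => x _; apply: sumr_ge0.
apply: (fun P0 U_le G_ge w_rec ell_rec => @fiber_bound R _
  (fun z : n.-tuple V => law nu p z) (Lscore S delta (n:=n))
  (@Egain R T S delta a b d n) (fun z => nblocks a b z == v)
  (@dblocks T a b d n) v q eps A mu Phi Hq Heps A0 P0 U_le G_ge
  Phi_ge0 Phi_mono Phi_conv w_rec ell_rec sg s dl h sg_gt0 s0 sg2 s2 erefl
  s160 s_q s_sg dl0 dl_le bad_le).
- by move=> z; apply: law_ge0.
- by move=> z /eqP <-; rewrite (nblocksE a b d) leq_addr.
- by move=> z; apply: Egain_ge.
(* For [f = 1] the inner sum is the number [v - u] of eligible blocks. *)
- move=> u uv; have := law_transport nu Hq u v (fun _ : n.-tuple V => 1).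
  under [in X in _ = X -> _]eq_bigr do rewrite mulr1.
  move=> <-; rewrite [RHS]mulrA; congr (_ * _); rewrite mulr_suml; apply: eq_bigr => z zuv.
  by rewrite big_const_seq count_predT iter_addr_0 (szE u).
- move=> u uv; rewrite -law_transport // [RHS]mulrA; congr (_ * _).
  rewrite mulr_suml; apply: eq_bigr => z zuv; rewrite -mulrA; congr (_ * _).
  have := szE u z zuv; rewrite /Egain.
  have vu : 0 < (v%:R : R) - u%:R by rewrite subr_gt0 ltr_nat.
  (* As [u < v], some block is eligible, so the default value 0 of [Egain] does not occur on this
     fibre. *)
  case: (eligible a b d z) => [|j e] se; first by move: vu; rewrite -se ltxx.
  rewrite se mulrDl mulrAC mulVf ?gt_eqF // mul1r sumrB.
  by rewrite big_const_seq count_predT iter_addr_0 -[in X in _ - X]mulr_natr se subrK.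
Qed.

(** Convexity between 0 and [r * x] with weight [r^-1]. *)
Lemma convex_superhomogeneous (x r : R) :
  Phi 0 = 0 -> 0 <= x -> 1 <= r -> r * Phi x <= Phi (r * x).
Proof.
move=> P0 x0 r1; have r0 : 0 < r by lra.
have t01 : 0 <= r^-1 <= 1 by rewrite invr_ge0 ltW //= invf_le1.
have := Phi_conv (mulr_ge0 (ltW r0) x0) (lexx 0) t01.
rewrite P0 !mulr0 !addr0 mulKf ?gt_eqF // => /(ler_wpM2l (ltW r0)).
by rewrite mulVKf ?gt_eqF.
Qed.

Let alpha := pAB nu p a b / 3.

Let g := 9 / 40 * h.

Let g_gt0 : 0 < g.
Proof. by rewrite mulr_gt0 ?divr_gt0 ?expR_gt0 // mulr_gt0. Qed.

(** Follows from [pi >= 2], as [2 * sg] is the square root of [4 q (1 - q)]. *)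
Lemma bq_ge : 2 * sg * expR ((2 * q * (1 - q))^-1) <= bq q.
Proof.
rewrite /bq ler_pM2r ?expR_gt0 //.
have -> : 2 * sg = Num.sqrt (4 * (q * (1 - q))).
  rewrite sqrtrM // (_ : 4 = 2 ^+ 2); last by ring.
  by rewrite sqrtr_sqr ger0_norm.
have pi2 := pi_ge2 R.
rewrite -[2 * pi * q * _]mulrA ler_sqrt; first by rewrite ler_pM2r //; lra.
by rewrite mulr_ge0 ?(ltW qq_gt0) //; lra.
Qed.

(** With [E] the exponential in [bq], [5 / 6 * g] equals [1 / (16 sg E)], and [bq_ge] bounds
    [2 sg E] by [bq q]. *)
Lemma bq_bound : Num.sqrt (2 * alpha) / (8 * bq q) <= 5 / 6 * Num.sqrt (2 * alpha) * g.
Proof.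
have bqE := bq_ge; set E := expR ((2 * q * (1 - q))^-1) in bqE.
have E0 : 0 < E by exact: expR_gt0.
have gE : g = 3 / (40 * sg * E).
  by rewrite /g /h expRN -/E; field; rewrite !gt_eqF.
have sE : 0 < 2 * sg * E by rewrite !mulr_gt0.
have -> : 5 / 6 * Num.sqrt (2 * alpha) * g = Num.sqrt (2 * alpha) / (8 * (2 * sg * E)).
  by rewrite gE; field; rewrite !gt_eqF.
have bq0 : 0 < bq q by exact: lt_le_trans bqE.
apply: ler_wpM2l; first exact: sqrtr_ge0.
rewrite lef_pV2; first by rewrite ler_pM2l.
all: by rewrite posrE mulr_gt0.
Qed.

Lemma bq_ge1 : 1 <= bq q.
Proof.
have /andP[q0 q1] := Hq; apply: le_trans bq_ge.
rewrite -[2 * q * _]mulrA -sg2.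
have sg_le : sg <= 1 by rewrite -(@expr_le1 _ 2) ?(ltW sg_gt0) // sg2; nra.
have i0 : 0 < (2 * sg ^+ 2)^-1 by rewrite invr_gt0 mulr_gt0 // exprn_gt0.
apply: (@le_trans _ _ (2 * sg * (2 * sg ^+ 2)^-1)); last first.
  rewrite ler_pM2l ?mulr_gt0 //; apply: le_trans (expR_ge1Dx _); lra.
have -> : 2 * sg * (2 * sg ^+ 2)^-1 = sg^-1 by field; rewrite gt_eqF.
by rewrite -[leLHS]invr1 lef_pV2 ?posrE.
Qed.

Lemma expect_bound (n : nat) (mu K dl Dn : R) :
  Phi 0 = 0 ->
  160 <= K -> 1 <= q * (1 - q) * K -> 2 + 18 * sg <= sg * K ->
  0 < dl -> (eps + A) * dl * 80 <= h * eps ->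
  K ^+ 2 <= alpha * n%:R / 2 -> 1000 <= n%:R :> R -> Dn <= dl * alpha / 70 ->
  \sum_(z : n.-tuple V | Egain S delta a b d z < eps) law nu p z <= Dn ->
  5 / 6 * Num.sqrt (2 * alpha) * g * Phi (eps * Num.sqrt (2 * alpha * n%:R) / 16)
  <= Expect nu p (fun z : n.-tuple V => Phi `|Lscore S delta z - mu|).
Proof.
move=> P0 K160 K_q K_sg dl0 dl_le Kn n1000 Dn_le badD.
have al0 : 0 < alpha by rewrite divr_gt0.
have n0 : 0 < (n%:R : R) by lra.
pose a2 := Num.sqrt (2 * alpha); pose rn := Num.sqrt (n%:R : R).
pose k3 := Num.sqrt (3 : R).
have a20 : 0 < a2 by rewrite sqrtr_gt0 mulr_gt0.
have rn0 : 0 < rn by rewrite sqrtr_gt0.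
have k30 : 0 < k3 by rewrite sqrtr_gt0.
have a2E : a2 ^+ 2 = 2 * alpha by rewrite sqr_sqrtr // mulr_ge0 // ltW.
have rnE : rn ^+ 2 = n%:R by rewrite sqr_sqrtr // ltW.
have k3E : k3 ^+ 2 = 3 by rewrite sqr_sqrtr.
have k3_ge : 17 / 10 <= k3.
  by rewrite -(@ler_pXn2r _ 2) ?nnegrE ?k3E ?ltW //; lra.
have -> : Num.sqrt (2 * alpha * n%:R) = a2 * rn by rewrite sqrtrM // mulr_ge0 // ltW.
(* The square of [y] is the threshold [alpha n / 2] for [v], and [X = eps y / 8] is the point of the
   statement. *)
pose y := a2 * rn / 2.
have y0 : 0 < y by rewrite !mulr_gt0.
have yE : y ^+ 2 = alpha * n%:R / 2 by rewrite /y expr_div_n exprMn a2E rnE; field.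
have -> : eps * (a2 * rn) / 16 = eps * y / 8 by rewrite /y; field.
set X := eps * y / 8.
have X0 : 0 <= X by rewrite divr_ge0 // mulr_ge0 // ltW.
have PX := Phi_ge0 X0.
pose Wt v := \sum_(z : n.-tuple V | nblocks a b z == v) law nu p z.
pose Bd v := \sum_(z : n.-tuple V | (nblocks a b z == v) && (Egain S delta a b d z < eps))
  law nu p z.
pose Ev v := \sum_(z : n.-tuple V | nblocks a b z == v)
  law nu p z * Phi `|Lscore S delta z - mu|.
pose m := (n %/ 3)%N.
(* From [v <= n / 3], that is [k3 * s <= rn] with [s] the root of [v], follows [tau * v <= s / y].
   Hence convexity gives [Phi (eps s / 8) >= tau v Phi X], a bound linear in [v]. *)
pose tau := 2 * k3 / (rn ^+ 2 * a2).
have tau0 : 0 < tau by rewrite divr_gt0 // mulr_gt0 // exprn_gt0.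
have law0 (s : seq V) : 0 <= law nu p s by apply: law_ge0.
have Wt0 v : 0 <= Wt v by apply: sumr_ge0.
have Bd0 v : 0 <= Bd v by apply: sumr_ge0.
have Ev0 v : 0 <= Ev v.
  by apply: sumr_ge0 => z _; rewrite mulr_ge0 // Phi_ge0.
have c0 : 0 <= g * Phi X * tau by exact: mulr_ge0 (mulr_ge0 (ltW g_gt0) PX) (ltW tau0).
(* The bracket is nonpositive for every discarded [v], i.e. [v < alpha n / 2] or
   [Bd v > dl * Wt v], so that summing over all [v] needs no case distinction. *)
have step v : (v <= m)%N ->
  g * Phi X * tau * (v%:R * Wt v - alpha * n%:R / 2 * Wt v - m%:R / dl * Bd v) <= Ev v.
  move=> vm; have vmR : (v%:R : R) <= m%:R by rewrite ler_nat.
  have W0 := Wt0 v.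
  have an0 : 0 <= alpha * n%:R / 2 * Wt v by rewrite mulr_ge0 // -yE sqr_ge0.
  have B0 : 0 <= m%:R / dl * Bd v by rewrite mulr_ge0 // divr_ge0 // ltW.
  have neg x : x <= 0 -> g * Phi X * tau * x <= Ev v.
    by move=> x0; apply: le_trans (Ev0 v); rewrite mulr_ge0_le0.
  have [v_lt|v_ge] := ltP v%:R (alpha * n%:R / 2).
    apply: neg; have : (v%:R - alpha * n%:R / 2) * Wt v <= 0.
      by rewrite mulr_le0_ge0 // subr_le0 ltW.
    lra.
  have [good|badv] := leP (Bd v) (dl * Wt v); last first.
    apply: neg.
    have : m%:R / dl * (dl * Wt v) <= m%:R / dl * Bd v.
      by apply: ler_wpM2l; [rewrite divr_ge0 // ltW | exact: ltW].
    have -> : m%:R / dl * (dl * Wt v) = m%:R * Wt v by field; rewrite gt_eqF.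
    have : v%:R * Wt v <= m%:R * Wt v by rewrite ler_wpM2r.
    lra.
  pose s := Num.sqrt (v%:R : R).
  have s0 : 0 <= s by rewrite sqrtr_ge0.
  have sE : s ^+ 2 = v%:R by rewrite sqr_sqrtr.
  have ys : y <= s by rewrite -(@ler_pXn2r _ 2) ?nnegrE ?(ltW y0) // yE sE.
  have Ks : K <= s.
    by rewrite -(@ler_pXn2r _ 2) ?nnegrE // ?sE ?(le_trans Kn) //; lra.
  have sq : 1 <= q * (1 - q) * s by rewrite (le_trans K_q) // ler_pM2l.
  have ssg : 2 + 18 * sg <= sg * s by rewrite (le_trans K_sg) // ler_pM2l.
  have := blocks_bound mu s0 sE (le_trans K160 Ks) sq ssg (ltW dl0) dl_le good.
  rewrite -/g -/(Wt v) -/(Ev v); apply: le_trans.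
  apply: (@le_trans _ _ (g * Phi X * tau * (v%:R * Wt v))).
    rewrite ler_wpM2l // -addrA gerDl.
    lra.
  rewrite [leLHS](_ : _ = g * (tau * v%:R * Phi X) * Wt v); last by ring.
  apply: ler_wpM2r => //; rewrite ler_pM2l //.
  have r1 : 1 <= s / y by rewrite ler_pdivlMr // mul1r.
  have := convex_superhomogeneous P0 X0 r1.
  have -> : s / y * X = eps * s / 8 by rewrite /X; field; rewrite gt_eqF.
  move=> H; apply: le_trans H; apply: ler_wpM2r => //.
  have k3s : k3 * s <= rn.
    rewrite -(@ler_pXn2r _ 2) ?nnegrE ?(ltW rn0) ?mulr_ge0 ?(ltW k30) //.
    by rewrite exprMn k3E sE rnE -natrM ler_nat mulnC -leq_divRL.
  rewrite ler_pdivlMr // -sE.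
  have -> : tau * s ^+ 2 * y = s * (k3 * s / rn).
    by rewrite /tau /y; field; rewrite !gt_eqF.
  by rewrite -[leRHS]mulr1 ler_wpM2l // ler_pdivrMr // mul1r.
have nb_le (z : n.-tuple V) : (nblocks a b z <= m)%N by exact: nblocks_le.
have -> : Expect nu p (fun z : n.-tuple V => Phi `|Lscore S delta z - mu|)
    = \sum_(0 <= v < m.+1) Ev v.
  by rewrite /Expect (@sum_fibers _ _ xpredT (@nblocks T a b n) m).
apply: (@le_trans _ _ (\sum_(0 <= v < m.+1) g * Phi X * tau *
   (v%:R * Wt v - alpha * n%:R / 2 * Wt v - m%:R / dl * Bd v))); last first.
  by rewrite big_nat [leRHS]big_nat ler_sum // => v /andP[_ vm]; apply: step.
rewrite -mulr_sumr !sumrB -!mulr_sumr.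
have -> : \sum_(0 <= v < m.+1) Wt v = 1.
  by rewrite -(@sum_fibers _ _ xpredT (@nblocks T a b n) m) // sum_law.
have -> : \sum_(0 <= v < m.+1) v%:R * Wt v = m%:R * (3 * alpha).
  rewrite (_ : 3 * alpha = pAB nu p a b); last by rewrite /alpha; field.
  rewrite -(expect_nblocks Hp1 Hnu1 Hstat).
  rewrite (@sum_fibers _ _ xpredT (@nblocks T a b n) m) //.
  apply: eq_bigr => v _; rewrite mulr_sumr; apply: eq_bigr => z /eqP ->.
  by rewrite mulrC.
have Bsum : \sum_(0 <= v < m.+1) Bd v <= Dn.
  apply: le_trans badD.
  rewrite (@sum_fibers _ _ (fun z => Egain S delta a b d z < eps) (@nblocks T a b n) m) //.
  by apply: ler_sum => v _; rewrite /Bd; under eq_bigl do rewrite andbC.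
have mB : m%:R / dl * \sum_(0 <= v < m.+1) Bd v <= m%:R * (alpha / 70).
  rewrite -mulrA ler_wpM2l // mulrC ler_pdivrMr //.
  by rewrite (le_trans Bsum) // (le_trans Dn_le) //; lra.
have m_hi : 3 * (m%:R : R) <= n%:R by rewrite -natrM ler_nat mulnC leq_divM.
have m_lo : (n%:R : R) <= 3 * m%:R + 2
  by rewrite -natrM -natrD ler_nat {1}(divn_eq n 3) mulnC leq_add2l -ltnS ltn_mod.
(* In units of [alpha n] the sum is at least [1 - 2 / 1000] from the mean of [V] with [n / 3]
   rounded down, minus [1 / 2] for the threshold, minus [1 / 210] for the bad event; the total
   exceeds [493 / 1000]. *)
apply: (@le_trans _ _ (g * Phi X * tau * (493 / 1000 * (alpha * n%:R)))); last first.
  rewrite ler_wpM2l //.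
  have : m%:R * alpha * 3 <= n%:R * alpha by rewrite mulrAC ler_pM2r // mulrC.
  have : n%:R * alpha <= (3 * m%:R + 2) * alpha by rewrite ler_pM2r.
  have : 1000 * alpha <= n%:R * alpha by rewrite ler_pM2r.
  lra.
rewrite -/a2.
have -> : g * Phi X * tau * (493 / 1000 * (alpha * n%:R))
   = (493 / 1000 * k3) * (a2 * g * Phi X).
  have -> : alpha = a2 ^+ 2 / 2 by rewrite a2E; field.
  by rewrite /tau -rnE; field; rewrite !gt_eqF.
rewrite [leLHS](_ : _ = 5 / 6 * (a2 * g * Phi X)); last by ring.
(* The constants fit because [k3 >= 17 / 10] makes [493 / 1000 * k3] larger than [5 / 6]. *)
apply: ler_wpM2r; last by lra.
exact: mulr_ge0 (mulr_ge0 (ltW a20) (ltW g_gt0)) PX.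
Qed.

End Assembly.

(** * Choice of the constants and reduction to a function vanishing at 0 *)

Theorem theorem3p3 (R : realType) (T : finType) (S : T -> T -> R) (delta : R)
  (HS : forall x y, 0 <= S x y)
  (nu : T * T -> R) (p : T * T -> T * T -> R)
  (Hp0 : forall E F, 0 <= p E F) (Hp1 : forall E, \sum_(F : T * T) p E F = 1)
  (Hprim : exists k, forall E F, 0 < ppow p k E F)
  (Hnu0 : forall E, 0 <= nu E) (Hnu1 : \sum_(E : T * T) nu E = 1)
  (Hstat : forall F, \sum_(E : T * T) nu E * p E F = nu F)
  (a b d : T * T) (HAB : 0 < pAB nu p a b)
  (Hq : 0 < qAB p a b d < 1)
  (Phi : R -> R) (HPhi0 : forall x, 0 <= x -> 0 <= Phi x)
  (HPhimono : forall x y, 0 <= x -> x <= y -> Phi x <= Phi y)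
  (HPhiconv : forall x y t, 0 <= x -> 0 <= y -> 0 <= t <= 1 ->
      Phi (t * x + (1 - t) * y) <= t * Phi x + (1 - t) * Phi y)
  (mu : nat -> R) (eps : R) (Heps : 0 < eps)
  (HA1 : exists Delta : nat -> R, Delta @ \oo --> (0 : R) /\
      forall n, 1 - Delta n <=
        Prob nu p (fun z : n.-tuple (T * T) => eps <= Egain S delta a b d z)) :
  let alpha := pAB nu p a b / 3 in
  forall c, 0 < c < Num.sqrt (2 * alpha) / (8 * bq (qAB p a b d)) ->
  exists N : nat, forall n : nat, (N <= n)%N ->
    c * Phi (eps * Num.sqrt (2 * alpha * n%:R) / 16)
      <= Expect nu p (fun z : n.-tuple (T * T) => Phi `|Lscore S delta z - mu n|).
Proof.
move=> alpha c /andP[c0 c_lt].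
have /andP[q0 q1] := Hq.
have al0 : 0 < alpha by rewrite divr_gt0.
have qq : 0 < qAB p a b d * (1 - qAB p a b d) by rewrite mulr_gt0 // subr_gt0.
have c_le1 : c <= 1.
  have bq1 := bq_ge1 Hq.
  have bq8 : 0 < 8 * bq (qAB p a b d) by lra.
  apply: le_trans (ltW c_lt) _; rewrite ler_pdivrMr // mul1r.
  apply: (@le_trans _ _ 1); last by lra.
  rewrite -[leRHS]sqrtr1 ler_sqrt //.
  by have := pAB_le1 Hp0 Hp1 Hnu0 Hnu1 a b; rewrite /alpha; lra.
have := bq_bound nu Hq; rewrite -/alpha => g_ge.
set g := 9 / 40 * _ in g_ge.
have {g_ge} c_g : c <= 5 / 6 * Num.sqrt (2 * alpha) * g by apply: le_trans (ltW c_lt) g_ge.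
pose sg := Num.sqrt (qAB p a b d * (1 - qAB p a b d)).
have sg0 : 0 < sg by rewrite sqrtr_gt0.
pose h := expR (- (2 * qAB p a b d * (1 - qAB p a b d))^-1) / (3 * sg).
have h0 : 0 < h by rewrite divr_gt0 ?expR_gt0 // mulr_gt0.
pose A := 2 * \sum_x \sum_y S x y.
have A0 : 0 <= A by rewrite mulr_ge0 // sumr_ge0 // => x _; apply: sumr_ge0.
have epsA : 0 < eps + A by lra.
pose dl := h * eps / (80 * (eps + A)).
have dl0 : 0 < dl by apply: divr_gt0; [exact: mulr_gt0 | rewrite mulr_gt0].
have dl_le : (eps + A) * dl * 80 <= h * eps.
  by rewrite le_eqVlt; apply/orP; left; apply/eqP; rewrite /dl; field; rewrite gt_eqF.
(* One summand for each of the three lower bounds required of the square root of [v]. *)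
pose K := 160 + (qAB p a b d * (1 - qAB p a b d))^-1 + (2 + 18 * sg) / sg.
have i0 : 0 < (qAB p a b d * (1 - qAB p a b d))^-1 by rewrite invr_gt0.
have j0 : 0 < (2 + 18 * sg) / sg by rewrite divr_gt0 //; lra.
have K160 : 160 <= K by rewrite /K; lra.
have K_q : 1 <= qAB p a b d * (1 - qAB p a b d) * K.
  by rewrite [leRHS]mulrC -ler_pdivrMr // mul1r /K; lra.
have K_sg : 2 + 18 * sg <= sg * K.
  by rewrite [leRHS]mulrC -ler_pdivrMr // /K; lra.
have [Delta [Delta0 HDelta]] := HA1.
have lim0 : 0 < dl * alpha / 70 by rewrite divr_gt0 // mulr_gt0.
have /cvgrPdist_lt /(_ _ lim0) [N1 _ HN1] := Delta0.
pose X := 1000 + 2 * K ^+ 2 / alpha.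
have K2 : 0 <= 2 * K ^+ 2 / alpha.
  by rewrite divr_ge0 ?(ltW al0) // mulr_ge0 // sqr_ge0.
exists (maxn N1 (Num.truncn X).+1) => n; rewrite geq_max => /andP[nN1 nX].
have Xn : X <= n%:R.
  by apply: le_trans (ltW (truncnS_gt X)) _; rewrite ler_nat.
have n1000 : 1000 <= n%:R :> R by rewrite /X in Xn; lra.
have Kn : K ^+ 2 <= alpha * n%:R / 2.
  have : 2 * K ^+ 2 / alpha <= n%:R by rewrite /X in Xn; lra.
  by rewrite ler_pdivrMr //; lra.
have Dn : Delta n <= dl * alpha / 70.
  have := HN1 n nN1; rewrite /= sub0r normrN => h1.
  exact: le_trans (ler_norm _) (ltW h1).
have bad_le : \sum_(z : n.-tuple (T * T) | Egain S delta a b d z < eps) law nu p z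
    <= Delta n.
  have := HDelta n; have := sum_law Hp1 Hnu1 n.
  rewrite (bigID (fun z : n.-tuple (T * T) => eps <= Egain S delta a b d z)) /= /Prob.
  under [X in _ + X = _ -> _]eq_bigl do rewrite -ltNge.
  lra.
(* Subtracting [Phi 0] keeps convexity and monotonicity; the constant is restored at the end at the
   cost [c * Phi 0 <= Phi 0], which is why [c <= 1] was established. *)
pose Psi x := Phi x - Phi 0.
have Psi_ge0 x : 0 <= x -> 0 <= Psi x by move=> x0; rewrite subr_ge0 HPhimono.
have Psi_mono x y : 0 <= x -> x <= y -> Psi x <= Psi y.
  by move=> x0 xy; rewrite lerD2r HPhimono.
have Psi_conv x y t : 0 <= x -> 0 <= y -> 0 <= t <= 1 ->
    Psi (t * x + (1 - t) * y) <= t * Psi x + (1 - t) * Psi y.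
  by move=> x0 y0 t01; have := HPhiconv x y t x0 y0 t01; rewrite /Psi; lra.
have Psi0 : Psi 0 = 0 by rewrite /Psi subrr.
have := expect_bound HS Hp0 Hp1 Hnu0 Hnu1 Hstat HAB Hq Psi_ge0 Psi_mono Psi_conv Heps
  (mu n) Psi0 K160 K_q K_sg dl0 dl_le Kn n1000 Dn bad_le.
rewrite -/alpha -/g.
set x := eps * _ / 16 => main.
have x0 : 0 <= x by rewrite divr_ge0 // mulr_ge0 ?sqrtr_ge0 // ltW.
have cPsi : c * Psi x <= 5 / 6 * Num.sqrt (2 * alpha) * g * Psi x.
  by rewrite ler_wpM2r // Psi_ge0.
have cPhi : c * Phi 0 <= Phi 0 by rewrite ler_piMl // HPhi0.
have -> : Expect nu p (fun z : n.-tuple (T * T) => Phi `|Lscore S delta z - mu n|)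
  = Expect nu p (fun z : n.-tuple (T * T) => Psi `|Lscore S delta z - mu n|) + Phi 0.
  rewrite /Expect -[in RHS](mul1r (Phi 0)) -(sum_law Hp1 Hnu1 n) mulr_suml -big_split.
  by apply: eq_bigr => z _; rewrite /Psi /=; ring.
have -> : c * Phi x = c * Psi x + c * Phi 0 by rewrite /Psi; ring.
lra.
Qed.
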